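(* Let $(X,\mathfrak{S})$ be a hierarchically hyperbolic space and let $A,B\subseteq X$ be $\kappa$-hierarchically quasiconvex subspaces. Then $A$ and $B$ fill all squares for some constant $T\ge0$ if and only if $A\cup B$ is $\widetilde\kappa$-hierarchically quasiconvex for some function $\widetilde\kappa$. Moreover, $T$ and $\widetilde\kappa$ each determine the other, together with $\kappa$, $\mathrm{d}_X(A,B)$ and $(X,\mathfrak{S})$: if $A\cup B$ is $\widetilde\kappa$-hierarchically quasiconvex then $A,B$ fill all squares with a constant $T$ depending only on $(X,\mathfrak{S})$, $\kappa$, $\widetilde\kappa$; and if $A,B$ fill all squares with constant $T$ then $A\cup B$ is $\widetilde\kappa$-hierarchically quasiconvex with $\widetilde\kappa$ depending only on $(X,\mathfrak{S})$, $\kappa$, $\mathrm{d}_X(A,B)$, $T$.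
   Context: A hierarchically hyperbolic space (HHS) $(X,\mathfrak{S})$ with constant $E>0$ is a hierarchical space in the sense of Behrstock–Hagen–Sisto (a quasigeodesic space $X$, a set $\mathfrak{S}$ of domains with nesting $\sqsubseteq$, orthogonality $\bot$, transversality $\pitchfork$, geodesic coordinate spaces $\mathcal C U$, $(E,E)$-coarsely Lipschitz projections $\pi_U\colon X\to 2^{\mathcal C U}$ with images of diameter $\le E$, relative projections $\rho^V_U$, satisfying the axioms of projections, nesting, orthogonality with containers, transversality and consistency, finite complexity, large links, bounded geodesic image, partial realisation, uniqueness) in which every $\mathcal C U$ is $E$-hyperbolic. Notation: $\mathrm{d}_U(P,Q)=\mathrm{d}_{\mathcal C U}(\pi_U(P),\pi_U(Q))$. A subset $Y\subseteq X$ is $\kappa$-hierarchically quasiconvex, for $\kappa\colon[0,\infty)\to[0,\infty)$, if $\pi_U(Y)$ is $\kappa(0)$-quasiconvex in $\mathcal C U$ for every $U\in\mathfrak{S}$, and for every $x\in X$ and $R\ge0$, if $\mathrm{d}_U(x,Y)\le R$ for all $U\in\mathfrak{S}$ then $\mathrm{d}_X(x,Y)\le\kappa(R)$. For a hierarchically quasiconvex $Y$, the gate $\mathfrak g_Y\colon X\to Y$ is a coarsely Lipschitz coarse retraction such that for all $x\in X$ and $W\in\mathfrak{S}$, $\pi_W(\mathfrak g_Y(x))$ uniformly coarsely coincides with the coarse closest point projection of $\pi_W(x)$ to $\pi_W(Y)$. For $P\subseteq Q$, $P$ is $T$-dense in $Q$ if $Q$ lies in the $T$-neighbourhood of $P$.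 Two subsets $A,B$ fill all squares (with constant $T$) if for every pair of orthogonal domains $U\bot V$, either $\pi_U(\mathfrak g_A(B))$ is $T$-dense in $\pi_U(A)$, or $\pi_V(\mathfrak g_B(A))$ is $T$-dense in $\pi_V(B)$. *)

(* Defs.v *)
From Stdlib Require Import Reals List.
Open Scope R_scope.


Section Coarse.
Variable T : Type.
Variable d : T -> T -> R.

Definition is_metric : Prop :=
  (forall x, d x x = 0) /\ (forall x y, d x y = d y x) /\
  (forall x y z, d x z <= d x y + d y z) /\ (forall x y, d x y = 0 -> x = y).

Definition diam_le (P : T -> Prop) (r : R) : Prop :=
  forall p q, P p -> P q -> d p q <= r.

(* d(P,Q) = inf {d p q | p in P, q in Q}; these predicates express
   inf <= r, inf < r, inf >= r respectively. *)
Definition setdist_le (P Q : T -> Prop) (r : R) : Prop :=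
  forall eps, 0 < eps -> exists p q, P p /\ Q q /\ d p q < r + eps.
Definition setdist_lt (P Q : T -> Prop) (r : R) : Prop :=
  exists p q, P p /\ Q q /\ d p q < r.
Definition setdist_ge (P Q : T -> Prop) (r : R) : Prop :=
  forall p q, P p -> Q q -> r <= d p q.

Definition nbhd (P : T -> Prop) (r : R) (q : T) : Prop :=
  exists p, P p /\ d p q <= r.

(* P is r-dense in Q (P need not be a subset of Q, as in "g_A(B) is dense in A") *)
Definition dense_in (P Q : T -> Prop) (r : R) : Prop :=
  forall q, Q q -> nbhd P r q.

Definition hausdorff_le (P Q : T -> Prop) (r : R) : Prop :=
  dense_in P Q r /\ dense_in Q P r.

Definition is_geod (g : R -> T) (L : R) : Prop :=
  0 <= L /\ forall s t, 0 <= s <= L -> 0 <= t <= L -> d (g s) (g t) = Rabs (s - t).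

Definition geod_img (g : R -> T) (L : R) (p : T) : Prop :=
  exists t, 0 <= t <= L /\ p = g t.

Definition geodesic_space : Prop :=
  forall x y, exists g, is_geod g (d x y) /\ g 0 = x /\ g (d x y) = y.

Definition hyperbolic (delta : R) : Prop :=
  forall x y z g1 L1 g2 L2 g3 L3,
    is_geod g1 L1 -> g1 0 = x -> g1 L1 = y ->
    is_geod g2 L2 -> g2 0 = y -> g2 L2 = z ->
    is_geod g3 L3 -> g3 0 = z -> g3 L3 = x ->
    forall p, geod_img g1 L1 p ->
      nbhd (fun q => geod_img g2 L2 q \/ geod_img g3 L3 q) delta p.

Definition quasiconvex (Z : T -> Prop) (k : R) : Prop :=
  forall g L, is_geod g L -> Z (g 0) -> Z (g L) ->
    forall p, geod_img g L p -> nbhd Z k p.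

Definition cpp (Z P : T -> Prop) (q : T) : Prop :=
  Z q /\ exists p, P p /\ forall q', Z q' -> d p q <= d p q' + 1.

Definition quasigeodesic_space (K : R) : Prop :=
  forall x y, exists (g : R -> T) (L : R), 0 <= L /\ g 0 = x /\ g L = y /\
    forall s t, 0 <= s <= L -> 0 <= t <= L ->
      Rabs (s - t) / K - K <= d (g s) (g t) <= K * Rabs (s - t) + K.
End Coarse.
Arguments is_metric {T}. Arguments diam_le {T}. Arguments setdist_le {T}.
Arguments setdist_lt {T}. Arguments setdist_ge {T}. Arguments nbhd {T}. Arguments dense_in {T}.
Arguments hausdorff_le {T}. Arguments is_geod {T}. Arguments geod_img {T}. Arguments geodesic_space {T}.
Arguments hyperbolic {T}. Arguments quasiconvex {T}. Arguments cpp {T}. Arguments quasigeodesic_space {T}.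

Section HHSAxioms.
Variables (X : Type) (dX : X -> X -> R).
Variables (Dom : Type) (nest orth : Dom -> Dom -> Prop).
Variables (C : Dom -> Type) (dC : forall U, C U -> C U -> R).
Variable proj : forall U, X -> C U -> Prop.
Variable rho : forall U V : Dom, C V -> Prop.                (* rho^U_V subset CV (U nested properly in V, or U transverse V) *)
Variable rhoD : forall V U : Dom, C V -> C U -> Prop.        (* rho^V_U : CV -> 2^{CU}  (U properly nested in V) *)
Variable E : R.
Variable theta : R -> R.

Definition pnest (U V : Dom) : Prop := nest U V /\ U <> V.
Definition transverse (U V : Dom) : Prop := ~ orth U V /\ ~ nest U V /\ ~ nest V U.

Definition projset (U : Dom) (Y : X -> Prop) (p : C U) : Prop :=
  exists y, Y y /\ proj U y p.
Definition projset_all (U : Dom) (p : C U) : Prop := exists y, proj U y p.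
Definition rhoD_set (V U : Dom) (P : C V -> Prop) (q : C U) : Prop :=
  exists p, P p /\ rhoD V U p q.

Definition HHS_axioms : Prop :=
  0 < E /\
  is_metric dX /\ quasigeodesic_space dX E /\
  (forall U, is_metric (dC U) /\ geodesic_space (dC U) /\ hyperbolic (dC U) E) /\
  (forall U x, exists p, proj U x p) /\
  (forall U x, diam_le (dC U) (proj U x) E) /\
  (forall U x y p q, proj U x p -> proj U y q -> dC U p q <= E * dX x y + E) /\
  (forall U, quasiconvex (dC U) (projset_all U) E) /\
  (forall U, nest U U) /\ (forall U V, nest U V -> nest V U -> U = V) /\
  (forall U V W, nest U V -> nest V W -> nest U W) /\
  ((exists U : Dom, True) -> exists S0, forall U, nest U S0) /\
  (forall V W, pnest V W -> (exists p, rho V W p) /\ diam_le (dC W) (rho V W) E) /\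
  (forall U V, orth U V -> orth V U) /\ (forall U, ~ orth U U) /\
  (forall U V W, nest V W -> orth W U -> orth V U) /\
  (forall U V, orth U V -> ~ nest U V) /\
  (forall T U, nest U T -> (exists V, nest V T /\ orth V U) ->
     exists W, pnest W T /\ forall V, orth V U -> nest V T -> nest V W) /\
  (forall V W, transverse V W -> (exists p, rho V W p) /\ diam_le (dC W) (rho V W) E) /\
  (forall V W x, transverse V W ->
     setdist_le (dC W) (proj W x) (rho V W) E \/
     setdist_le (dC V) (proj V x) (rho W V) E) /\
  (forall V W x, pnest V W ->
     setdist_le (dC W) (proj W x) (rho V W) E \/
     diam_le (dC V) (fun q => proj V x q \/ rhoD_set W V (proj W x) q) E) /\
  (forall U V W, nest U V -> (pnest V W \/ (transverse V W /\ ~ orth W U)) ->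
     setdist_le (dC W) (rho U W) (rho V W) E) /\
  (exists n : nat, forall l : list Dom, NoDup l ->
     (forall U V, In U l -> In V l -> nest U V \/ nest V U) -> (length l <= n)%nat) /\
  (* large links (with lambda = E) *)
  (forall W x x' r, setdist_le (dC W) (proj W x) (proj W x') r ->
     exists l : list Dom, INR (length l) <= E * r + E /\
       (forall Ti, In Ti l -> pnest Ti W /\
          setdist_le (dC W) (proj W x) (rho Ti W) (E * r + E)) /\
       (forall T, pnest T W -> (exists Ti, In Ti l /\ nest T Ti) \/
          setdist_lt (dC T) (proj T x) (proj T x') E)) /\
  (forall V W g L, pnest V W -> is_geod (dC W) g L ->
     diam_le (dC V) (rhoD_set W V (geod_img g L)) E \/
     exists p, geod_img g L p /\ nbhd (dC W) (rho V W) E p) /\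
  (forall l : list {V : Dom & C V},
     (forall i j a b, nth_error l i = Some a -> nth_error l j = Some b -> i <> j ->
        orth (projT1 a) (projT1 b)) ->
     (forall a, In a l -> projset_all (projT1 a) (projT2 a)) ->
     exists x, forall a, In a l ->
       setdist_le (dC (projT1 a)) (proj (projT1 a) x) (eq (projT2 a)) E /\
       (forall V, pnest (projT1 a) V -> setdist_le (dC V) (proj V x) (rho (projT1 a) V) E) /\
       (forall W, transverse W (projT1 a) -> setdist_le (dC W) (proj W x) (rho (projT1 a) W) E)) /\
  (forall k x y, 0 <= k -> theta k <= dX x y ->
     exists V, setdist_ge (dC V) (proj V x) (proj V y) k).
End HHSAxioms.
Arguments projset {X Dom C} proj. Arguments projset_all {X Dom C} proj. Arguments rhoD_set {Dom C} rhoD.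
Arguments pnest {Dom}. Arguments transverse {Dom}.
Arguments HHS_axioms {X} dX {Dom} nest orth {C} dC proj rho rhoD E theta.

Record HHS : Type := {
  pt : Type;
  dX : pt -> pt -> R;
  dom : Type;
  nest : dom -> dom -> Prop;
  orth : dom -> dom -> Prop;
  CS : dom -> Type;
  dC : forall U, CS U -> CS U -> R;
  proj : forall U, pt -> CS U -> Prop;
  rho : forall U V : dom, CS V -> Prop;
  rhoD : forall V U : dom, CS V -> CS U -> Prop;
  hhsE : R;
  theta : R -> R;
  hhs_ax : HHS_axioms dX nest orth dC proj rho rhoD hhsE theta }.

Definition hqc (H : HHS) (Y : pt H -> Prop) (kappa : R -> R) : Prop :=
  (forall U, quasiconvex (@dC H U) (projset (@proj H) U Y) (kappa 0)) /\
  (forall x r, 0 <= r ->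
     (forall U, setdist_le (@dC H U) (@proj H U x) (projset (@proj H) U Y) r) ->
     setdist_le (@dX H) (eq x) Y (kappa r)).

Definition is_gate (H : HHS) (Y : pt H -> Prop) (g : pt H -> pt H) (mu : R) : Prop :=
  (forall x, Y (g x)) /\
  (forall y, Y y -> @dX H (g y) y <= mu) /\
  (forall x x', @dX H (g x) (g x') <= mu * @dX H x x' + mu) /\
  (forall W x, hausdorff_le (@dC H W) (@proj H W (g x))
                 (cpp (@dC H W) (projset (@proj H) W Y) (@proj H W x)) mu).

Definition image {T : Type} (f : T -> T) (B : T -> Prop) (y : T) : Prop :=
  exists b, B b /\ y = f b.

Definition fill_all_squares (H : HHS) (A B : pt H -> Prop) (gA gB : pt H -> pt H) (T : R) : Prop :=
  forall U V, @orth H U V ->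
    dense_in (@dC H U) (projset (@proj H) U (image gA B)) (projset (@proj H) U A) T \/
    dense_in (@dC H V) (projset (@proj H) V (image gB A)) (projset (@proj H) V B) T.

Definition setU {T : Type} (A B : T -> Prop) (x : T) : Prop := A x \/ B x.
Arguments hqc {H}. Arguments is_gate {H}. Arguments fill_all_squares {H}.

(* Main.v *)
Require Import Defs.
From Stdlib Require Import Reals List.
From Stdlib Require Import Lra Lia Classical ClassicalEpsilon.
Open Scope R_scope.

(** Let [U ⊥ V], let [a] in [A] be far in [U] from the gate of [B] in [A], and [b] in [B] far in [V]
    from the gate of [A] in [B].  The tuple equal to [b] on domains nested in [V], to [a] on domains
    orthogonal to [V] and to [rho V _] elsewhere is consistent, hence realised by a point [x]; since
    [B] has large image in [V], each [rho V W] is close to [B], so [x] is close to the union in every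
    domain, while [V] and [U] show that [x] is far from [A] and from [B] in the space.

    Conversely, if [x] is close to the union in every domain, far from [A] in [U] and far from [B]
    in [V], then consistency and the pair of points realising the distance between [A] and [B] force
    [U ⊥ V], and there the filling of squares is violated.

    The maps [rhoD] may have empty values, so bounded geodesic image is unusable; large links,
    combined with the gates, take its place. *)

(** * Finite lists: maximal elements and finite choice *)

(** The order properties are asked only on [P]: the relation [before] used below is shown to be
    transitive only among maximal bad domains. *)
Lemma maximal_in_list {T : Type} (P : T -> Prop) (Rel : T -> T -> Prop) :
  (forall a, P a -> ~ Rel a a) ->
  (forall a b c, P a -> P b -> P c -> Rel a b -> Rel b c -> Rel a c) ->
  forall l a, In a l -> P a ->
  exists m, In m l /\ P m /\ forall w, In w l -> P w -> ~ Rel m w.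
Proof.
  intros Hirr Htr l. induction l as [|h t IH]; intros a Ha Pa; [contradiction|].
  destruct (classic (exists b, In b t /\ P b)) as [[b [Hb Pb]]|Hno].
  - destruct (IH b Hb Pb) as [m [Hm [Pm Hmax]]].
    destruct (classic (P h /\ Rel m h)) as [[Ph Hmh]|Hn].
    + exists h. split; [now left|]. split; [exact Ph|].
      intros w [<-|Hw] Pw Hr; [now apply (Hirr h Ph)|].
      apply (Hmax w Hw Pw). now apply (Htr m h w).
    + exists m. split; [now right|]. split; [exact Pm|].
      intros w [<-|Hw] Pw Hr; [now apply Hn|]. now apply (Hmax w Hw Pw).
  - assert (a = h) as ->.
    { destruct Ha as [Ha|Ha]; [easy|]. exfalso. apply Hno. now exists a. }
    exists h. split; [now left|]. split; [exact Pa|].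
    intros w [<-|Hw] Pw Hr; [now apply (Hirr h Pa)|]. apply Hno. now exists w.
Qed.

Lemma list_union_exists {S T : Type} (Q : S -> list T -> Prop) (l : list S) :
  (forall s, In s l -> exists L, Q s L) ->
  exists L, (forall t, In t L -> exists s Ls, In s l /\ Q s Ls /\ In t Ls) /\
    (forall s, In s l -> exists Ls, Q s Ls /\ incl Ls L).
Proof.
  induction l as [|h t IH]; intros Hl.
  - exists nil. split; intros ? [].
  - destruct IH as [L [H1 H2]]; [intros s Hs; apply Hl; now right|].
    destruct (Hl h (or_introl eq_refl)) as [Lh Hh].
    exists (Lh ++ L). split.
    + intros x Hx. apply in_app_or in Hx as [Hx|Hx].
      * exists h, Lh. repeat split; trivial. now left.
      * destruct (H1 x Hx) as [s [Ls [A [B C]]]]. exists s, Ls. repeat split; trivial. now right.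
    + intros s [<-|Hs].
      * exists Lh. split; [exact Hh|apply incl_appl, incl_refl].
      * destruct (H2 s Hs) as [Ls [A B]]. exists Ls. split; [exact A|now apply incl_appr].
Qed.

(** * Closest points in hyperbolic spaces *)

Section Hyperbolic.
Variable (T : Type) (d : T -> T -> R) (delta : R).
Hypothesis Hmet : is_metric d.
Hypothesis Hgeo : geodesic_space d.
Hypothesis Hhyp : hyperbolic d delta.

Lemma metric_refl x : d x x = 0. Proof. apply Hmet. Qed.
Lemma metric_sym x y : d x y = d y x. Proof. apply Hmet. Qed.
Lemma metric_tri x y z : d x z <= d x y + d y z. Proof. apply Hmet. Qed.
Lemma metric_pos x y : 0 <= d x y.
Proof.
  pose proof (metric_tri x y x). rewrite metric_refl, (metric_sym y x) in H. lra.
Qed.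

Lemma geod_length g L : is_geod d g L -> d (g 0) (g L) = L.
Proof.
  intros [HL Hg]. rewrite Hg by lra. rewrite Rabs_minus_sym, Rabs_right; lra.
Qed.

Lemma geod_img_split g L m : is_geod d g L -> geod_img g L m ->
  d (g 0) m + d m (g L) = L.
Proof.
  intros [HL Hg] [t [Ht ->]]. rewrite !Hg by lra.
  rewrite (Rabs_left1 (0 - t)), (Rabs_left1 (t - L)); lra.
Qed.

Lemma thin_triangle x y z g L : is_geod d g L -> g 0 = x -> g L = y ->
  exists g2 L2 g3 L3,
    is_geod d g2 L2 /\ g2 0 = y /\ g2 L2 = z /\
    is_geod d g3 L3 /\ g3 0 = z /\ g3 L3 = x /\
    forall p, geod_img g L p -> exists q, d q p <= delta /\ (geod_img g2 L2 q \/ geod_img g3 L3 q).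
Proof.
  intros Hg H0 HL.
  destruct (Hgeo y z) as [g2 [G2 [A2 B2]]]. destruct (Hgeo z x) as [g3 [G3 [A3 B3]]].
  exists g2, (d y z), g3, (d z x). repeat split; trivial; try apply G2; try apply G3.
  intros p Hp. destruct (Hhyp x y z g L g2 _ g3 _ Hg H0 HL G2 A2 B2 G3 A3 B3 p Hp) as [q [Hq Hd]].
  now exists q.
Qed.

(** The slack [1] is that of [cpp]; an exact closest point may fail to exist. *)
Definition near_closest (Z : T -> Prop) (p c : T) : Prop :=
  Z c /\ forall q, Z q -> d p c <= d p q + 1.

(** If [c0] is not near [c], go a distance [t] from [c] towards [c0]. Thinness puts that point near
    the geodesic from [c0] to [p], as wanted, or near the one from [p] to [c]; then a point of [Z]
    next to it is too close to [p]. *)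
Lemma closest_point_near_geodesic (Z : T -> Prop) k p c c0 g L :
  0 <= delta -> 0 <= k -> quasiconvex d Z k -> near_closest Z p c -> Z c0 ->
  is_geod d g L -> g 0 = c0 -> g L = p ->
  exists m, geod_img g L m /\ d c m <= 3 * delta + k + 2.
Proof.
  intros Hdel Hk Hq [Zc Hc] Zc0 Hg H0 HL.
  destruct (Hgeo p c) as [g3 [G3 [A3 B3]]]. destruct (Hgeo c c0) as [g1 [G1 [A1 B1]]].
  (* In the excluded case a point of [Z] is closer to [p] than [c] by at least
     [t - 2 * delta - k = 2], more than the slack [1]. *)
  set (t := 2 * delta + k + 2).
  destruct (Rlt_le_dec (d c c0) t) as [Hlt|Hle].
  - exists c0. split; [exists 0; split; [destruct Hg; lra|easy]|]. unfold t in Hlt. lra.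
  - assert (Hm : geod_img g1 (d c c0) (g1 t)) by (exists t; split; [unfold t; unfold t in Hle; lra|easy]).
    assert (Dm : d c (g1 t) = t).
    { rewrite <- A1 at 1. destruct G1 as [_ G1].
      rewrite G1 by (unfold t; unfold t in Hle; lra).
      rewrite Rabs_left1; unfold t; lra. }
    destruct (Hhyp c c0 p g1 _ g L g3 _ G1 A1 B1 Hg H0 HL G3 A3 B3 _ Hm) as [s [[Hs|Hs] Ds]].
    + exists s. split; [exact Hs|].
      pose proof (metric_tri c (g1 t) s). rewrite (metric_sym (g1 t) s) in H. unfold t in *. lra.
    + exfalso.
      destruct (Hq g1 _ G1 ltac:(now rewrite A1) ltac:(now rewrite B1) _ Hm) as [q [Zq Dq]].
      pose proof (geod_img_split _ _ _ G3 Hs) as Hsp. rewrite A3, B3 in Hsp.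
      pose proof (Hc q Zq).
      pose proof (metric_tri p s q). pose proof (metric_tri s (g1 t) q).
      pose proof (metric_tri c s (g1 t)).
      rewrite (metric_sym q (g1 t)) in Dq. rewrite (metric_sym s c) in Hsp.
      unfold t in *. lra.
Qed.

(** The geodesic from [c'] to [p] passes near [c] at [m]. As [c'] is nearly closest to [p'], its
    part from [c'] to [m] has length at most [2 * d p p'] up to constants. *)
Lemma closest_point_coarsely_lipschitz (Z : T -> Prop) k p p' c c' :
  0 <= delta -> 0 <= k -> quasiconvex d Z k -> near_closest Z p c -> near_closest Z p' c' ->
  d c c' <= 2 * d p p' + 6 * delta + 2 * k + 5.
Proof.
  intros Hdel Hk Hq Hc Hc'.
  destruct (Hgeo c' p) as [g [G [A B]]].
  destruct (closest_point_near_geodesic Z k p c c' g _ Hdel Hk Hq Hc (proj1 Hc') G A B) as [m [Hm Dm]].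
  pose proof (geod_img_split _ _ _ G Hm) as Hs. rewrite A, B in Hs.
  pose proof (proj2 Hc' c (proj1 Hc)).
  pose proof (metric_tri p p' c'). pose proof (metric_tri p' p c).
  pose proof (metric_tri p m c). pose proof (metric_tri c m c').
  rewrite (metric_sym c' p), (metric_sym c' m), (metric_sym m p) in Hs.
  rewrite (metric_sym m c) in *. rewrite (metric_sym p' p) in *. lra.
Qed.

(** Two thin triangles fill the quadrilateral [p, z1, z2, q]: two of its sides follow [Z1] and [Z2],
    and the one from [z1] to [z2] is short. *)
Lemma geodesic_between_near_quasiconvex (Z1 Z2 : T -> Prop) k D z1 z2 p q g L :
  0 <= delta -> 0 <= k -> 0 <= D ->
  quasiconvex d Z1 k -> quasiconvex d Z2 k -> Z1 z1 -> Z2 z2 -> d z1 z2 <= D ->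
  Z1 p -> Z2 q -> is_geod d g L -> g 0 = p -> g L = q ->
  forall m, geod_img g L m -> exists m', (Z1 m' \/ Z2 m') /\ d m' m <= 2 * delta + k + D.
Proof.
  intros Hdel Hk HD Q1 Q2 Hz1 Hz2 Hz Hp Hq Hg H0 HL m Hm.
  destruct (thin_triangle p q z1 g L Hg H0 HL)
    as [g2 [L2 [g3 [L3 [G2 [A2 [B2 [G3 [A3 [B3 Ht]]]]]]]]]].
  destruct (Ht m Hm) as [s [Ds [Hs|Hs]]].
  - destruct (thin_triangle q z1 z2 g2 L2 G2 A2 B2)
      as [g4 [L4 [g5 [L5 [G4 [A4 [B4 [G5 [A5 [B5 Ht']]]]]]]]]].
    destruct (Ht' s Hs) as [u [Du [Hu|Hu]]].
    + exists z1. split; [now left|].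
      pose proof (geod_img_split _ _ _ G4 Hu) as Hsp. rewrite A4, B4 in Hsp.
      pose proof (geod_length _ _ G4) as Hl. rewrite A4, B4 in Hl.
      pose proof (metric_pos u z2).
      pose proof (metric_tri z1 u m). pose proof (metric_tri u s m). lra.
    + destruct (Q2 g5 L5 G5 ltac:(now rewrite A5) ltac:(now rewrite B5) u Hu) as [v [Zv Dv]].
      exists v. split; [now right|].
      pose proof (metric_tri v u m). pose proof (metric_tri u s m). lra.
  - destruct (Q1 g3 L3 G3 ltac:(now rewrite A3) ltac:(now rewrite B3) s Hs) as [v [Zv Dv]].
    exists v. split; [now left|].
    pose proof (metric_tri v s m). lra.
Qed.

Lemma quasiconvex_union (Z1 Z2 : T -> Prop) k D z1 z2 :
  0 <= delta -> 0 <= k -> 0 <= D ->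
  quasiconvex d Z1 k -> quasiconvex d Z2 k -> Z1 z1 -> Z2 z2 -> d z1 z2 <= D ->
  quasiconvex d (fun p => Z1 p \/ Z2 p) (2 * delta + k + D).
Proof.
  intros Hdel Hk HD Q1 Q2 Hz1 Hz2 Hz g L Hg [H0|H0] [HL|HL] m Hm.
  - destruct (Q1 g L Hg H0 HL m Hm) as [q [Zq Dq]]. exists q. split; [now left|lra].
  - destruct (geodesic_between_near_quasiconvex Z1 Z2 k D z1 z2 _ _ g L
      Hdel Hk HD Q1 Q2 Hz1 Hz2 Hz H0 HL Hg eq_refl eq_refl m Hm) as [q [Zq Dq]].
    now exists q.
  - rewrite metric_sym in Hz.
    destruct (geodesic_between_near_quasiconvex Z2 Z1 k D z2 z1 _ _ g L
      Hdel Hk HD Q2 Q1 Hz2 Hz1 Hz H0 HL Hg eq_refl eq_refl m Hm) as [q [Zq Dq]].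
    exists q. tauto.
  - destruct (Q2 g L Hg H0 HL m Hm) as [q [Zq Dq]]. exists q. split; [now right|lra].
Qed.

(** [c] is near the geodesic from [z1] to [p], which by thinness follows [Z2] or the short side from
    [z1] to [z2]. *)
Lemma closest_point_near_other_set (Z1 Z2 : T -> Prop) k D z1 z2 p c :
  0 <= delta -> 0 <= k -> 0 <= D ->
  quasiconvex d Z1 k -> quasiconvex d Z2 k -> Z1 z1 -> Z2 z2 -> d z1 z2 <= D ->
  Z2 p -> near_closest Z1 p c -> exists q, Z2 q /\ d c q <= 4 * delta + 2 * k + D + 2.
Proof.
  intros Hdel Hk HD Q1 Q2 Hz1 Hz2 Hz Hp Hc.
  destruct (Hgeo z1 p) as [g [G [A B]]].
  destruct (closest_point_near_geodesic Z1 k p c z1 g _ Hdel Hk Q1 Hc Hz1 G A B) as [m [Hm Dm]].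
  destruct (thin_triangle z1 p z2 g _ G A B)
    as [g2 [L2 [g3 [L3 [G2 [A2 [B2 [G3 [A3 [B3 Ht]]]]]]]]]].
  destruct (Ht m Hm) as [s [Ds [Hs|Hs]]].
  - destruct (Q2 g2 L2 G2 ltac:(now rewrite A2) ltac:(now rewrite B2) s Hs) as [q [Zq Dq]].
    exists q. split; [exact Zq|].
    pose proof (metric_tri c m q). pose proof (metric_tri m s q).
    rewrite (metric_sym m s), (metric_sym s q) in *. lra.
  - exists z2. split; [exact Hz2|].
    pose proof (geod_img_split _ _ _ G3 Hs) as Hsp. rewrite A3, B3 in Hsp.
    pose proof (geod_length _ _ G3) as Hl. rewrite A3, B3 in Hl.
    pose proof (metric_pos s z1). pose proof (metric_tri c m z2). pose proof (metric_tri m s z2).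
    rewrite (metric_sym m s), (metric_sym s z2), (metric_sym z2 z1) in *. lra.
Qed.
End Hyperbolic.

(** * Representatives of coarse points *)

Section HHSGeometry.
Variable H : HHS.

Notation X := (pt H).
Notation Dom := (dom H).
Notation E := (hhsE H).
Notation "U ⊑ V" := (@nest H U V) (at level 70).
Notation "U ⊏ V" := (pnest (@nest H) U V) (at level 70).
Notation "U ⊥ V" := (@orth H U V) (at level 70).
Notation "U ⋔ V" := (transverse (@nest H) (@orth H) U V) (at level 70).

Ltac hhs_axiom := destruct (hhs_ax H) as
  (?&?&?&?&?&?&?&?&?&?&?&?&?&?&?&?&?&?&?&?&?&?&?&?&?&?&?).

Lemma E_pos : 0 < E. Proof. hhs_axiom; assumption. Qed.
Lemma dX_metric : is_metric (@dX H). Proof. hhs_axiom; assumption. Qed.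
Lemma dC_metric U : is_metric (@dC H U).
Proof. destruct (hhs_ax H) as (_&_&_&M&_). apply M. Qed.
Lemma dC_geodesic U : geodesic_space (@dC H U).
Proof. destruct (hhs_ax H) as (_&_&_&M&_). apply M. Qed.
Lemma dC_hyperbolic U : hyperbolic (@dC H U) E.
Proof. destruct (hhs_ax H) as (_&_&_&M&_). apply M. Qed.
Lemma proj_nonempty U x : exists p, @proj H U x p. Proof. hhs_axiom; auto. Qed.
Lemma proj_diam U x p q : @proj H U x p -> @proj H U x q -> dC H U p q <= E.
Proof. destruct (hhs_ax H) as (_&_&_&_&_&M&_). apply M. Qed.
Lemma proj_lipschitz U x y p q : @proj H U x p -> @proj H U y q -> dC H U p q <= E * dX H x y + E.
Proof. destruct (hhs_ax H) as (_&_&_&_&_&_&M&_). apply M. Qed.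
Lemma nest_refl U : U ⊑ U. Proof. hhs_axiom; auto. Qed.
Lemma nest_antisym U V : U ⊑ V -> V ⊑ U -> U = V. Proof. hhs_axiom; auto. Qed.
Lemma nest_trans U V W : U ⊑ V -> V ⊑ W -> U ⊑ W. Proof. hhs_axiom; eauto. Qed.
Lemma nest_top (U : Dom) : exists S0, forall V, V ⊑ S0.
Proof. destruct (hhs_ax H) as (_&_&_&_&_&_&_&_&_&_&_&M&_). apply M. now exists U. Qed.
Lemma orth_sym U V : U ⊥ V -> V ⊥ U. Proof. hhs_axiom; auto. Qed.
Lemma orth_nest U V W : V ⊑ W -> W ⊥ U -> V ⊥ U. Proof. hhs_axiom; eauto. Qed.
Lemma orth_not_nest U V : U ⊥ V -> ~ U ⊑ V. Proof. hhs_axiom; auto. Qed.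
Lemma orth_container V Y : Y ⊑ V -> (exists W, W ⊑ V /\ W ⊥ Y) ->
  exists Z, Z ⊏ V /\ forall W, W ⊥ Y -> W ⊑ V -> W ⊑ Z.
Proof. hhs_axiom; auto. Qed.
Lemma rho_bounded V W : V ⊏ W \/ V ⋔ W ->
  (exists p, @rho H V W p) /\ diam_le (@dC H W) (@rho H V W) E.
Proof. hhs_axiom. intros [Hn|Hn]; auto. Qed.

Lemma trv_sym U V : U ⋔ V -> V ⋔ U.
Proof. intros (A&B&C). repeat split; trivial. intros D. now apply A, orth_sym. Qed.
Lemma pnest_trans U V W : U ⊏ V -> V ⊏ W -> U ⊏ W.
Proof.
  intros [A B] [C D]. split; [now apply (nest_trans U V W)|]. intros <-.
  now apply B, nest_antisym.
Qed.
Lemma pnest_not_nest U V : U ⊏ V -> ~ V ⊑ U.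
Proof. intros [A B] C. now apply B, nest_antisym. Qed.
Lemma domain_cases U V : U ⊑ V \/ U ⊥ V \/ V ⊏ U \/ U ⋔ V.
Proof.
  destruct (classic (U ⊑ V)) as [|N]; [tauto|]. destruct (classic (U ⊥ V)) as [|N2]; [tauto|].
  destruct (classic (V ⊑ U)) as [N3|N3].
  - right; right; left. split; [exact N3|]. intros ->. now apply N.
  - right; right; right. repeat split; assumption.
Qed.

(** Finite complexity bounds the length of chains, and putting [V] on top of a chain below [U ⊏ V]
    lengthens it, so the bound drops from [V] to [U]. *)
Lemma pnest_wf : well_founded (pnest (@nest H)).
Proof.
  assert (Hfc : exists n : nat, forall l : list Dom, NoDup l ->
     (forall U V, In U l -> In V l -> U ⊑ V \/ V ⊑ U) -> (length l <= n)%nat)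
    by (hhs_axiom; assumption).
  destruct Hfc as [n Hn].
  assert (Hk : forall k V, (forall l : list Dom, NoDup l ->
     (forall U V, In U l -> In V l -> U ⊑ V \/ V ⊑ U) ->
     (forall U, In U l -> U ⊑ V) -> (length l <= k)%nat) -> Acc (pnest (@nest H)) V).
  { induction k as [|k IH]; intros V HV.
    - specialize (HV (V :: nil)). simpl in HV. exfalso.
      enough (1 <= 0)%nat by lia. apply HV.
      + constructor; [intros []|constructor].
      + intros U W [<-|[]] [<-|[]]. left; apply nest_refl.
      + intros U [<-|[]]. apply nest_refl.
    - constructor. intros U HU. apply IH. intros l ND Hc Hb.
      enough (length (V :: l) <= S k)%nat by (simpl in *; lia).
      apply HV.
      + constructor; [|exact ND]. intros HI. now apply (pnest_not_nest U V HU), Hb.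
      + intros W W' [<-|HW] [<-|HW'].
        * left; apply nest_refl.
        * right. apply (nest_trans _ U); [now apply Hb|apply HU].
        * left. apply (nest_trans _ U); [now apply Hb|apply HU].
        * now apply Hc.
      + intros W [<-|HW]; [apply nest_refl|]. apply (nest_trans _ U); [now apply Hb|apply HU]. }
  intros V. apply (Hk n). intros l ND Hc _. now apply Hn.
Qed.

(** Coarse points are replaced by chosen representatives, at the cost of enlarging
    the constants; [rrep V U] is junk unless [rho V U] is nonempty. *)
Definition rep (U : Dom) (x : X) : CS H U :=
  proj1_sig (constructive_indefinite_description _ (proj_nonempty U x)).

Lemma rep_proj U x : proj H U x (rep U x).
Proof. exact (proj2_sig (constructive_indefinite_description _ (proj_nonempty U x))). Qed.

Lemma partial_realisation_sets (l : list {V : Dom & CS H V}) :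
  (forall i j a b, nth_error l i = Some a -> nth_error l j = Some b -> i <> j ->
     projT1 a ⊥ projT1 b) ->
  (forall a, In a l -> projset_all (@proj H) (projT1 a) (projT2 a)) ->
  exists x, forall a, In a l ->
    setdist_le (@dC H (projT1 a)) (@proj H (projT1 a) x) (eq (projT2 a)) E /\
    (forall V, projT1 a ⊏ V -> setdist_le (@dC H V) (@proj H V x) (@rho H (projT1 a) V) E) /\
    (forall W, W ⋔ projT1 a -> setdist_le (@dC H W) (@proj H W x) (@rho H (projT1 a) W) E).
Proof.
  destruct (hhs_ax H) as
  (_&_&_&_&_&_&_&_&_&_&_&_&_&_&_&_&_&_&_&_&_&_&_&_&_&M&_). apply M.
Qed.

(** Partial realisation of the empty family yields a point. *)
Lemma pt_inhabited : inhabited X.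
Proof.
  destruct (partial_realisation_sets nil) as [x _].
  - intros i j a b Hi. destruct i; discriminate.
  - intros a [].
  - exact (inhabits x).
Qed.

Lemma CS_inhabited U : inhabited (CS H U).
Proof. destruct pt_inhabited as [x]. exact (inhabits (rep U x)). Qed.

Definition rrep (V U : Dom) : CS H U := epsilon (CS_inhabited U) (@rho H V U).

Lemma rrep_rho V U : V ⊏ U \/ V ⋔ U -> @rho H V U (rrep V U).
Proof. intros HV. exact (epsilon_spec (CS_inhabited U) _ (proj1 (rho_bounded V U HV))). Qed.

(** The first argument of [dd], [dr] and [rr] is the domain in which the distance is taken; [r]
    stands for a relative projection to it. *)
Definition dd (U : Dom) (x y : X) : R := dC H U (rep U x) (rep U y).
Definition dr (U : Dom) (x : X) (V : Dom) : R := dC H U (rep U x) (rrep V U).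
Definition rr (U V W : Dom) : R := dC H U (rrep V U) (rrep W U).
(** Comes from [large_links_near], which adds two errors [3 * E + 1], each an axiom constant [E],
    two diameters [E] and the slack [1] of an infimum. *)
Definition hhsK : R := 6 * E + 2.
Notation K := hhsK.

Lemma K_ge : 1 <= K /\ 6 * E + 2 <= K. Proof. unfold K. pose proof E_pos. lra. Qed.

Lemma dC_refl U p : dC H U p p = 0. Proof. apply dC_metric. Qed.
Lemma dC_sym U p q : dC H U p q = dC H U q p. Proof. apply dC_metric. Qed.
Lemma dC_tri U p q r : dC H U p r <= dC H U p q + dC H U q r. Proof. apply dC_metric. Qed.
Lemma dC_pos U p q : 0 <= dC H U p q. Proof. apply metric_pos, dC_metric. Qed.
Lemma dd_sym U x y : dd U x y = dd U y x. Proof. apply dC_sym. Qed.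
Lemma dd_tri U x y z : dd U x z <= dd U x y + dd U y z. Proof. apply dC_tri. Qed.
Lemma dd_pos U x y : 0 <= dd U x y. Proof. apply dC_pos. Qed.
Lemma rr_sym U V W : rr U V W = rr U W V. Proof. apply dC_sym. Qed.
Lemma dr_dd U x y V : dr U x V <= dd U x y + dr U y V. Proof. apply dC_tri. Qed.
Lemma dr_rr U x V W : dr U x V <= dr U x W + rr U W V. Proof. apply dC_tri. Qed.
Lemma dd_dr U x y V : dd U x y <= dr U x V + dr U y V.
Proof. unfold dr. rewrite (dC_sym U (rep U y)). apply dC_tri. Qed.
Lemma rr_dr U x V W : rr U V W <= dr U x V + dr U x W.
Proof. unfold dr, rr. rewrite (dC_sym U (rep U x) (rrep V U)). apply dC_tri. Qed.

Lemma rep_near U x p : proj H U x p -> dC H U (rep U x) p <= E.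
Proof. apply proj_diam, rep_proj. Qed.
Lemma rrep_near U V p : V ⊏ U \/ V ⋔ U -> rho H V U p -> dC H U (rrep V U) p <= E.
Proof. intros HV Hp. apply (proj2 (rho_bounded V U HV)); [now apply rrep_rho|exact Hp]. Qed.

Lemma dr_of_setdist U V x r : V ⊏ U \/ V ⋔ U ->
  setdist_le (@dC H U) (proj H U x) (rho H V U) r -> dr U x V <= r + 2 * E + 1.
Proof.
  intros HV Hs. destruct (Hs 1 Rlt_0_1) as [p [q [Hp [Hq Hd]]]].
  pose proof (rep_near U x p Hp). pose proof (rrep_near U V q HV Hq).
  unfold dr. pose proof (dC_tri U (rep U x) p (rrep V U)). pose proof (dC_tri U p q (rrep V U)).
  rewrite (dC_sym U q) in *. lra.
Qed.

Lemma dd_lipschitz U x y : dd U x y <= K * dX H x y + K.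
Proof.
  pose proof (proj_lipschitz U x y _ _ (rep_proj U x) (rep_proj U y)).
  pose proof E_pos. pose proof K_ge. pose proof (metric_pos _ _ dX_metric x y). unfold dd. nra.
Qed.

Lemma trv_consistent V W x : V ⋔ W -> dr W x V <= K \/ dr V x W <= K.
Proof.
  intros HVW.
  assert (Hc : setdist_le (dC H W) (proj H W x) (rho H V W) E \/
     setdist_le (dC H V) (proj H V x) (rho H W V) E) by (hhs_axiom; auto).
  pose proof E_pos. unfold K.
  destruct Hc as [Hc|Hc]; [left|right]; (apply dr_of_setdist in Hc; [lra|]); right; [|apply trv_sym]; exact HVW.
Qed.

(** Non-orthogonality of [W] and [U] makes [U] itself properly nested in or transverse to [W], so
    that [rrep U W] is not junk. *)
Lemma rho_nest U V W : U ⊑ V -> V ⊏ W \/ V ⋔ W -> ~ W ⊥ U -> rr W U V <= K.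
Proof.
  intros HUV HVW Ho.
  assert (Hs : setdist_le (dC H W) (rho H U W) (rho H V W) E).
  { destruct (hhs_ax H) as (_&_&_&_&_&_&_&_&_&_&_&_&_&_&_&_&_&_&_&_&_&M&_).
    apply M; tauto. }
  assert (HUW : U ⊏ W \/ U ⋔ W).
  { destruct (classic (U = V)) as [->|Hne]; [exact HVW|].
    destruct HVW as [HVW|HVW]; [left; now apply (pnest_trans U V W)|].
    destruct HVW as (A&B&C).
    destruct (classic (U ⊑ W)) as [N|N].
    - left. split; [exact N|]. now intros ->.
    - right. split; [|split].
      + intros D. now apply Ho, orth_sym.
      + exact N.
      + intros D. apply C. now apply (nest_trans W U V). }
  destruct (Hs 1 Rlt_0_1) as [p [q [Hp [Hq Hd]]]].
  pose proof (rrep_near W U p HUW Hp). pose proof (rrep_near W V q HVW Hq).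
  unfold rr, K. pose proof (dC_tri W (rrep U W) p (rrep V W)).
  pose proof (dC_tri W p q (rrep V W)). rewrite (dC_sym W q) in *. pose proof E_pos. lra.
Qed.

Lemma large_links_sets W x x' : exists l : list Dom,
  (forall T, In T l -> T ⊏ W /\ dr W x T <= E * dd W x x' + 3 * E + 1) /\
  (forall T, T ⊏ W -> K < dd T x x' -> exists T', In T' l /\ T ⊑ T').
Proof.
  assert (Hll : exists l : list Dom, INR (length l) <= E * dd W x x' + E /\
       (forall Ti, In Ti l -> Ti ⊏ W /\
          setdist_le (dC H W) (proj H W x) (rho H Ti W) (E * dd W x x' + E)) /\
       (forall T, T ⊏ W -> (exists Ti, In Ti l /\ T ⊑ Ti) \/
          setdist_lt (dC H T) (proj H T x) (proj H T x') E)).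
  { destruct (hhs_ax H) as (_&_&_&_&_&_&_&_&_&_&_&_&_&_&_&_&_&_&_&_&_&_&_&M&_).
    apply M with (x' := x'). intros eps He. exists (rep W x), (rep W x').
    repeat split; try apply rep_proj. fold (dd W x x'). lra. }
  destruct Hll as [l [_ [H1 H2]]]. exists l. split.
  - intros T HT. destruct (H1 T HT) as [A B]. split; [exact A|].
    apply dr_of_setdist in B; [lra|now left].
  - intros T HT Hd. destruct (H2 T HT) as [Hn|[p [q [Hp [Hq Hlt]]]]]; [exact Hn|exfalso].
    pose proof (rep_near T x p Hp). pose proof (rep_near T x' q Hq).
    unfold dd, K in Hd. pose proof (dC_tri T (rep T x) p (rep T x')).
    pose proof (dC_tri T p q (rep T x')). rewrite (dC_sym T q) in *. pose proof E_pos. lra.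
Qed.

(** A form of the bounded geodesic image property for pairs of points that are close
    in [W]; unlike the axiom, it does not involve the (possibly empty) maps [rhoD]. *)
Lemma large_links_near T W x x' : T ⊏ W -> K < dd T x x' -> dr W x T <= K * dd W x x' + K.
Proof.
  intros HT Hd. destruct (large_links_sets W x x') as [l [H1 H2]].
  destruct (H2 T HT Hd) as [T' [HT' Hn]]. destruct (H1 T' HT') as [Hp Hr].
  assert (Hr' : rr W T T' <= 3 * E + 1).
  { assert (Hs : setdist_le (dC H W) (rho H T W) (rho H T' W) E).
    { destruct (hhs_ax H) as (_&_&_&_&_&_&_&_&_&_&_&_&_&_&_&_&_&_&_&_&_&M&_).
      apply M; tauto. }
    destruct (Hs 1 Rlt_0_1) as [p [q [Hp' [Hq Hd']]]].
    pose proof (rrep_near W T p (or_introl HT) Hp').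
    pose proof (rrep_near W T' q (or_introl Hp) Hq).
    unfold rr. pose proof (dC_tri W (rrep T W) p (rrep T' W)).
    pose proof (dC_tri W p q (rrep T' W)). rewrite (dC_sym W q) in *. lra. }
  pose proof (dr_rr W x T T'). rewrite (rr_sym W T' T) in *.
  pose proof (dd_pos W x x'). pose proof E_pos. unfold K. nra.
Qed.

(** * Partial realisation on orthogonal families *)

(** Stated by positions, as in the axiom, so a repeated entry would be orthogonal to itself. *)
Definition pairwise_orth (l : list Dom) : Prop :=
  forall i j U V, nth_error l i = Some U -> nth_error l j = Some V -> i <> j -> U ⊥ V.

Lemma pairwise_orth_cons U l : pairwise_orth l -> (forall V, In V l -> V ⊥ U) ->
  pairwise_orth (U :: l).
Proof.
  intros Hl HU [|i] [|j] V W Hi Hj Hij; simpl in *.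
  - easy.
  - injection Hi as <-. apply orth_sym, HU. now apply nth_error_In with j.
  - injection Hj as <-. apply HU. now apply nth_error_In with i.
  - apply (Hl i j); trivial. lia.
Qed.

Definition partially_realises (tau : Dom -> X) (x : X) (U : Dom) : Prop :=
  dd U x (tau U) <= K /\ forall W, U ⊏ W \/ U ⋔ W -> dr W x U <= K.

Lemma partial_realisation (tau : Dom -> X) (l : list Dom) : pairwise_orth l ->
  exists x, forall U, In U l -> partially_realises tau x U.
Proof.
  intros Hl.
  destruct (partial_realisation_sets
    (map (fun U => existT (fun V => CS H V) U (rep U (tau U))) l)) as [x Hx].
  - intros i j a b Hi Hj Hij. rewrite nth_error_map in Hi, Hj.
    destruct (nth_error l i) eqn:Ei; [|discriminate].
    destruct (nth_error l j) eqn:Ej; [|discriminate].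
    injection Hi as <-. injection Hj as <-. simpl. now apply (Hl i j).
  - intros a Ha. apply in_map_iff in Ha as [U [<- _]]. simpl. exists (tau U). apply rep_proj.
  - exists x. intros U HU.
    destruct (Hx (existT _ U (rep U (tau U)))) as [H1 [H2 H3]].
    { apply in_map_iff. now exists U. }
    simpl in *. pose proof E_pos. split.
    + destruct (H1 1 Rlt_0_1) as [p [q [Hp [<- Hd]]]].
      pose proof (rep_near U x p Hp). unfold dd, K.
      pose proof (dC_tri U (rep U x) p (rep U (tau U))). lra.
    + intros W HW.
      assert (dr W x U <= E + 2 * E + 1); [|unfold K; lra].
      apply dr_of_setdist; [exact HW|]. destruct HW as [HW|HW]; [now apply H2|].
      now apply H3, trv_sym.
Qed.

Lemma partial_realisation_single (z : X) (U : Dom) :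
  exists x, partially_realises (fun _ => z) x U.
Proof.
  destruct (partial_realisation (fun _ => z) (U :: nil)) as [x Hx].
  - apply pairwise_orth_cons; [intros [|i] j V W Hi; discriminate|intros V []].
  - exists x. apply Hx. now left.
Qed.

(** One point realising both [U] and [V] is near both relative projections. *)
Lemma rho_orth U V W : U ⊥ V -> (U ⊏ W \/ U ⋔ W) -> (V ⊏ W \/ V ⋔ W) ->
  rr W U V <= 2 * K.
Proof.
  intros Ho HU HV. destruct pt_inhabited as [z].
  destruct (partial_realisation (fun _ => z) (U :: V :: nil)) as [x Hx].
  - repeat apply pairwise_orth_cons.
    + intros [|i] j V' W' Hi; discriminate.
    + intros V' [].
    + intros V' [<-|[]]. now apply orth_sym.
  - destruct (Hx U (or_introl eq_refl)) as [_ A].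
    destruct (Hx V (or_intror (or_introl eq_refl))) as [_ B].
    pose proof (A W HU). pose proof (B W HV). pose proof (rr_dr W x U V). lra.
Qed.

(** * Realisation of consistent tuples *)

Section Realisation.
(** A tuple is given by points: its coordinate in [W] is the projection of [tau W]. Finitely many
    values allow finitely many uses of large links, and in [tau_nest] equality of points replaces
    the consistency clause on [rhoD]. *)
Variable (tau : Dom -> X) (range : list X) (kap : R).
Hypothesis tau_range : forall W, In (tau W) range.
Hypothesis kap_ge : K <= kap.
Hypothesis tau_trv : forall V W, V ⋔ W -> dr V (tau V) W <= kap \/ dr W (tau W) V <= kap.
Hypothesis tau_nest : forall V W, V ⊏ W -> tau V = tau W \/ dr W (tau W) V <= kap.

Definition error (x : X) (W : Dom) : R := dd W x (tau W).
(** A domain with larger error is called bad. After subtracting [kap] and one [K], more than [3 * K]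
    is left to separate relative projections. *)
Definition bad_bound : R := kap + 4 * K.
(** The bound of [bad_below_near_rho] for a domain [W] that is not bad. *)
Definition rho_bound : R := kap + K * bad_bound + K.

Lemma error_dr x W V : dr W (tau W) V <= error x W + dr W x V.
Proof. unfold error. rewrite dd_sym. apply dr_dd. Qed.
Lemma error_le x W V : error x W <= dr W x V + dr W (tau W) V.
Proof. apply dd_dr. Qed.

(** If [tau V = tau W], this point and [x] are far apart in [V], so large links puts it near
    [rho V W], up to the error in [W]. *)
Lemma bad_below_near_rho x V W : V ⊏ W -> K < error x V ->
  dr W (tau W) V <= kap + K * error x W + K.
Proof.
  intros HVW Hb. pose proof K_ge. pose proof (dd_pos W x (tau W)) as Hpos. fold (error x W) in Hpos.
  destruct (tau_nest V W HVW) as [Ht|Ht]; [|nra].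
  pose proof (large_links_near V W (tau W) x HVW) as Hl.
  rewrite <- Ht, dd_sym in Hl at 1. specialize (Hl Hb).
  rewrite (dd_sym W (tau W) x) in Hl. fold (error x W) in Hl. lra.
Qed.

(** If [V] is not in [Bad], large links for [x] and each value of the tuple gives finitely many
    domains properly below [V] that cover the members of [Bad]; recurse in each of them. *)
Lemma bad_domains_finitely_covered x (Bad : Dom -> Prop) :
  (forall W, Bad W -> K < error x W) ->
  forall V, exists L, (forall W, In W L -> Bad W) /\
    forall W, W ⊑ V -> Bad W -> exists W', In W' L /\ W ⊑ W'.
Proof.
  intros HB V. induction V as [V IH] using (well_founded_induction pnest_wf).
  destruct (classic (Bad V)) as [BV|NV].
  { exists (V :: nil). split; [intros W [<-|[]]; exact BV|].
    intros W HW _. exists V. split; [now left|exact HW]. }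
  destruct (list_union_exists (fun y l => (forall T, In T l -> T ⊏ V) /\
    (forall T, T ⊏ V -> K < dd T x y -> exists T', In T' l /\ T ⊑ T')) range) as [M [M1 M2]].
  { intros y _. destruct (large_links_sets V x y) as [l [A B]]. exists l.
    split; [intros T HT; now apply A|exact B]. }
  destruct (list_union_exists (fun T L => (forall W, In W L -> Bad W) /\
    forall W, W ⊑ T -> Bad W -> exists W', In W' L /\ W ⊑ W') M) as [L [L1 L2]].
  { intros T HT. destruct (M1 T HT) as [y [l [_ [[A _] B]]]]. apply IH. now apply A. }
  exists L. split.
  - intros W HW. destruct (L1 W HW) as [T [l [_ [[A _] B]]]]. now apply A.
  - intros W HW BW.
    assert (HWV : W ⊏ V) by (split; [exact HW|now intros ->]).
    destruct (M2 (tau W) (tau_range W)) as [l [[_ A] B]].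
    destruct (A W HWV (HB W BW)) as [T [HT HWT]].
    destruct (L2 T (B T HT)) as [l' [[_ A'] B']].
    destruct (A' W HWT BW) as [W' [C D]]. exists W'. split; [now apply B'|exact D].
Qed.

(** Among the maximal bad domains, [Y] is the last one met when travelling from [x]
    towards the tuple: transversality orders them, and a last one exists by finiteness. *)
Lemma last_bad_domain x (V : Dom) (Fam : Dom -> Prop) (W0 : Dom) :
  (forall W, Fam W -> W ⊑ V) ->
  Fam W0 -> bad_bound < error x W0 ->
  exists Y, Fam Y /\ bad_bound < error x Y /\
    forall W, Fam W -> Y ⊏ W \/ Y ⋔ W -> dr W (tau W) Y <= rho_bound.
Proof.
  intros HV HW0 HbW0. pose proof K_ge as HK.
  assert (Hbb : bad_bound = kap + 4 * K) by reflexivity.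
  assert (Hrb : rho_bound = kap + K * bad_bound + K) by reflexivity.
  assert (Hrb' : bad_bound + kap + K <= rho_bound) by nra.
  set (Bad := fun W => Fam W /\ bad_bound < error x W).
  set (Mx := fun W => Bad W /\ forall W', Bad W' -> W ⊑ W' -> W = W').
  destruct (bad_domains_finitely_covered x Bad) with (V := V) as [L [L1 L2]].
  { intros W [_ Hb]. lra. }
  assert (Hup : forall W, Bad W -> exists m, In m L /\ W ⊑ m /\ Mx m).
  { intros W BW. destruct (L2 W (HV W (proj1 BW)) BW) as [l [Hl HWl]].
    destruct (maximal_in_list (fun m => W ⊑ m) (pnest (@nest H))) with (l := L) (a := l)
      as [m [Hm [HWm Hmax]]]; trivial.
    - intros a _ [_ N]. now apply N.
    - intros a b c _ _ _. apply pnest_trans.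
    - exists m. split; [exact Hm|]. split; [exact HWm|]. split; [now apply L1|].
      intros W' BW' Hn.
      destruct (L2 W' (HV W' (proj1 BW')) BW') as [l' [Hl' Hn']].
      apply nest_antisym; [exact Hn|]. apply NNPP. intros Hc.
      assert (Hml : m ⊑ l') by now apply (nest_trans m W' l').
      apply (Hmax l' Hl'); [now apply (nest_trans W m l')|].
      split; [exact Hml|]. intros ->. now apply Hc. }
  (* On the way from [x] to the tuple, [m] changes first: while it does, the coordinate in [w] rests
     at [rho m w], where [x] has it by [Hbef]. *)
  set (before := fun m w => m ⋔ w /\ dr m (tau m) w <= kap).
  assert (Hbef : forall m w, Mx m -> before m w -> dr w x m <= K).
  { intros m w [[_ Hm] _] [Ht Hd]. destruct (trv_consistent m w x Ht) as [|Hc]; [assumption|].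
    pose proof (error_le x m w). lra. }
  destruct (Hup W0 (conj HW0 HbW0)) as [m0 [Hm0 [_ Mm0]]].
  destruct (maximal_in_list Mx before) with (l := L) (a := m0) as [Y [HY [MY Hlast]]]; trivial.
  - intros a _ [(_&N&_) _]. apply N, nest_refl.
  - intros m w v Mm Mw Mv Hmw Hwv.
    pose proof (Hbef m w Mm Hmw) as Hxw. pose proof (Hbef w v Mw Hwv) as Hxv.
    destruct Hmw as [Tmw Dmw]. destruct Hwv as [Twv Dwv].
    (* In [w], [x] is near [rho m w] and the tuple near [rho v w], but [w] is bad. This separation
       leaves only transversality of [m] and [v]. *)
    assert (Hfar : 3 * K < rr w m v).
    { pose proof (proj2 (proj1 Mw)). pose proof (error_le x w v).
      pose proof (dr_rr w x v m). lra. }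
    destruct (domain_cases m v) as [C|[C|[C|C]]].
    + exfalso. assert (m = v) as -> by (apply Mm; [apply Mv|exact C]).
      unfold rr in Hfar. rewrite dC_refl in Hfar. lra.
    + exfalso. pose proof (rho_orth m v w C (or_intror Tmw) (or_intror (trv_sym _ _ Twv))). lra.
    + exfalso. destruct C as [C C']. apply C'. apply Mv; [apply Mm|exact C].
    + split; [exact C|].
      (* A point realising [m] shows that [rho m v] and [rho w v] are close, so [x] is near
         [rho m v] as well and the tuple in the bad domain [v] cannot be. *)
      destruct (partial_realisation_single x m) as [p [_ Hp]].
      pose proof (Hp w (or_intror Tmw)) as Pw. pose proof (Hp v (or_intror C)) as Pv.
      destruct (trv_consistent w v p Twv) as [Hc|Hc].
      2:{ exfalso. pose proof (rr_dr w p m v). lra. }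
      destruct (tau_trv m v C) as [|Hd]; [assumption|exfalso].
      pose proof (rr_dr v p m w). pose proof (dr_rr v x m w). rewrite (rr_sym v w m) in *.
      pose proof (error_le x v m). pose proof (proj2 (proj1 Mv)). lra.
  - exists Y. destruct MY as [[FY BY] MaxY]. split; [exact FY|]. split; [exact BY|].
    intros W FW HYW.
    destruct (Rle_lt_dec (error x W) bad_bound) as [Hg|Hb].
    + destruct HYW as [HYW|HYW].
      * pose proof (bad_below_near_rho x Y W HYW ltac:(lra)). nra.
      * destruct (Rle_lt_dec (dr W (tau W) Y) rho_bound) as [|Hc]; [assumption|exfalso].
        destruct (tau_trv Y W HYW) as [Ht|Ht]; [|lra].
        destruct (trv_consistent Y W x HYW) as [Hx|Hx].
        -- pose proof (error_dr x W Y). lra.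
        -- pose proof (error_le x Y W). lra.
    + destruct HYW as [[HYW N]|HYW].
      { exfalso. apply N. apply MaxY; [now split|exact HYW]. }
      (* [W] need not be maximal: compare [Y] with a maximal bad [w] above [W], and return to [W]
         because [rho w Y] and [rho W Y] are close. *)
      destruct (Hup W (conj FW Hb)) as [w [Hw [HWw Mw]]].
      assert (Tw : w ⋔ Y).
      { destruct (domain_cases w Y) as [C|[C|[[C C']|C]]]; [exfalso..|exact C].
        - destruct HYW as (_&_&N). apply N. now apply (nest_trans W w Y).
        - destruct HYW as (N&_). apply N, orth_sym. now apply (orth_nest Y W w).
        - apply C', MaxY; [apply Mw|exact C]. }
      assert (Nw : kap < dr Y (tau Y) w).
      { apply Rnot_le_lt. intros Hc. apply (Hlast w Hw Mw). split; [now apply trv_sym|exact Hc]. }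
      destruct (tau_trv w Y Tw) as [Ht|Ht]; [|lra].
      destruct (trv_consistent w Y x Tw) as [Hx|Hx].
      2:{ exfalso. pose proof (error_le x w Y). pose proof (proj2 (proj1 Mw)). lra. }
      pose proof (rho_nest W w Y HWw (or_intror Tw) ltac:(apply HYW)) as Hr.
      destruct (tau_trv Y W HYW) as [Hu|Hu]; [exfalso|nra].
      pose proof (dr_rr Y x W w). rewrite (rr_sym Y w W) in *.
      pose proof (error_le x Y W). lra.
Qed.

(** The intermediate [Y0] lets [Y] shrink without new estimates, since [rho Y W] stays close to
    [rho Y0 W]. *)
Definition anchored (Fam : Dom -> Prop) (Y : Dom) : Prop :=
  Fam Y /\ forall W, Fam W -> ~ W ⊥ Y -> W ⊑ Y \/
    exists Y0, Y ⊑ Y0 /\ (Y0 ⊏ W \/ Y0 ⋔ W) /\ dr W (tau W) Y0 <= rho_bound.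

(** If a point realising [Y] has a bad domain below [Y], the last one is proper, because the error
    in [Y] is at most [K], and is again anchored. Descent terminates by well-foundedness. *)
Lemma anchored_descent (Fam : Dom -> Prop) :
  (forall V W, V ⊑ W -> Fam W -> Fam V) ->
  forall Y, anchored Fam Y -> exists Y', anchored Fam Y' /\
    forall x, partially_realises tau x Y' -> forall W, W ⊑ Y' -> error x W <= bad_bound.
Proof.
  intros Hdown Y. induction Y as [Y IH] using (well_founded_induction pnest_wf). intros [FY HY].
  destruct (classic (forall x, partially_realises tau x Y ->
    forall W, W ⊑ Y -> error x W <= bad_bound)) as [Hg|Hn]; [now exists Y|].
  apply not_all_ex_not in Hn as [x Hn]. apply imply_to_and in Hn as [Px Hn].
  apply not_all_ex_not in Hn as [W0 Hn]. apply imply_to_and in Hn as [HW0 Hn].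
  apply Rnot_le_lt in Hn.
  destruct (last_bad_domain x Y (fun W => W ⊑ Y) W0) as [Y' [HY' [BY' Hr]]]; trivial.
  assert (Hp : Y' ⊏ Y).
  { split; [exact HY'|]. intros ->. destruct Px as [Px _]. fold (error x Y) in Px.
    unfold bad_bound in BY'. pose proof K_ge. lra. }
  apply (IH Y' Hp). split; [now apply (Hdown Y' Y)|].
  intros W FW NW.
  assert (NW' : ~ W ⊥ Y).
  { intros C. apply NW, orth_sym, (orth_nest W Y' Y HY'), orth_sym, C. }
  destruct (HY W FW NW') as [HWY|[Y0 [A [B C]]]].
  - destruct (domain_cases W Y') as [C|[C|[C|C]]]; [now left|contradiction|right..];
      exists Y'; (split; [apply nest_refl|]).
    + split; [now left|]. apply Hr; tauto.
    + apply trv_sym in C. split; [now right|]. apply Hr; tauto.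
  - right. exists Y0. split; [now apply (nest_trans Y' Y Y0)|]. now split.
Qed.

Definition realisation_bound : R := rho_bound + bad_bound + 2 * K.

(** Once an anchor [Y] is fixed, the domains left over are orthogonal to [Y] and hence
    lie in a proper container, so the construction recurses on the nesting order. *)
Lemma realising_family V : forall Fam : Dom -> Prop,
  (forall U W, U ⊑ W -> Fam W -> Fam U) -> (forall W, Fam W -> W ⊑ V) ->
  exists L, pairwise_orth L /\ (forall U, In U L -> Fam U) /\
    forall x, (forall U, In U L -> partially_realises tau x U) ->
    forall W, Fam W -> error x W <= realisation_bound.
Proof.
  pose proof K_ge as HK.
  assert (Hbb : bad_bound = kap + 4 * K) by reflexivity.
  assert (Hrb : rho_bound = kap + K * bad_bound + K) by reflexivity.
  assert (Hrl : realisation_bound = rho_bound + bad_bound + 2 * K) by reflexivity.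
  assert (Hpos : 0 <= rho_bound) by nra.
  assert (Hnil : pairwise_orth nil) by (intros [|i] j U W Hi; discriminate).
  induction V as [V IH] using (well_founded_induction pnest_wf). intros Fam Hdown HV.
  destruct (classic (forall x W, Fam W -> error x W <= bad_bound)) as [Hg|Hn].
  { exists nil. split; [exact Hnil|]. split; [intros U []|].
    intros x _ W FW. specialize (Hg x W FW). lra. }
  apply not_all_ex_not in Hn as [x0 Hn]. apply not_all_ex_not in Hn as [W0 Hn].
  apply imply_to_and in Hn as [FW0 Hn]. apply Rnot_le_lt in Hn.
  destruct (last_bad_domain x0 V Fam W0 HV FW0 Hn) as [Y1 [FY1 [_ HY1]]].
  assert (A1 : anchored Fam Y1).
  { split; [exact FY1|]. intros W FW NW.
    destruct (domain_cases W Y1) as [C|[C|[C|C]]]; [now left|contradiction|right..];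
      exists Y1; (split; [apply nest_refl|]).
    - split; [now left|]. apply HY1; tauto.
    - apply trv_sym in C. split; [now right|]. apply HY1; tauto. }
  destruct (anchored_descent Fam Hdown Y1 A1) as [Y [[FY HY] HY2]].
  assert (Hrest : exists L, pairwise_orth L /\ (forall U, In U L -> Fam U /\ U ⊥ Y) /\
    forall x, (forall U, In U L -> partially_realises tau x U) ->
    forall W, Fam W /\ W ⊥ Y -> error x W <= realisation_bound).
  { destruct (classic (exists W, W ⊑ V /\ W ⊥ Y)) as [Hex|Hno].
    - destruct (orth_container V Y (HV Y FY) Hex) as [Z [HZ HZc]].
      apply (IH Z HZ (fun W => Fam W /\ W ⊥ Y)).
      + intros U W HUW [FW OW]. split; [now apply (Hdown U W)|now apply (orth_nest Y U W)].
      + intros W [FW OW]. apply HZc; [exact OW|now apply HV].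
    - exists nil. split; [exact Hnil|]. split; [intros U []|].
      intros x _ W [FW OW]. exfalso. apply Hno. exists W. split; [now apply HV|exact OW]. }
  destruct Hrest as [L [PL [FL HL]]].
  exists (Y :: L). split; [apply pairwise_orth_cons; [exact PL|intros U HU; now apply FL]|].
  split; [intros U [<-|HU]; [exact FY|now apply FL]|].
  intros x Hx W FW.
  destruct (classic (W ⊥ Y)) as [OW|NW].
  { apply HL; [intros U HU; apply Hx; now right|now split]. }
  pose proof (Hx Y (or_introl eq_refl)) as PY.
  destruct (classic (W ⊑ Y)) as [SW|NS]; [pose proof (HY2 x PY W SW); lra|].
  destruct (HY W FW NW) as [|[Y0 [HYY [HYW Hd]]]]; [contradiction|].
  (* In [W], [x] is near [rho Y W], this is near [rho Y0 W], and the tuple is near the latter. *)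
  assert (dr W x Y <= K).
  { apply (proj2 PY). destruct (domain_cases W Y) as [C|[C|[C|C]]]; try contradiction.
    - now left.
    - right. now apply trv_sym. }
  pose proof (rho_nest Y Y0 W HYY HYW NW). pose proof (dr_rr W x Y0 Y).
  pose proof (error_le x W Y0). lra.
Qed.

Theorem realisation : exists x, forall W, dd W x (tau W) <= realisation_bound.
Proof.
  destruct (classic (exists U : Dom, True)) as [[U _]|Hno].
  - destruct (nest_top U) as [S0 HS].
    destruct (realising_family S0 (fun _ => True) (fun _ _ _ _ => I) (fun W _ => HS W)) as [L [PL [_ HL]]].
    destruct (partial_realisation tau L PL) as [x Hx]. exists x. intros W. now apply (HL x Hx).
  - destruct pt_inhabited as [x]. exists x. intros W. exfalso. apply Hno. now exists W.
Qed.
End Realisation.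

(** * Mixing two points along a domain and its orthogonal complement *)

Definition mixed_bound : R := realisation_bound (4 * K) + 4 * K.

Lemma mixed_realisation (V : Dom) (a b : X) : exists x,
  (forall W, W ⊑ V -> dd W x b <= mixed_bound) /\
  (forall W, W ⊥ V -> dd W x a <= mixed_bound) /\
  (forall W, V ⊏ W \/ V ⋔ W -> dr W x V <= mixed_bound).
Proof.
  pose proof K_ge as HK.
  (* [p] stands in for [rho V _] above and across [V], so the tuple takes only three values. *)
  destruct (partial_realisation_single b V) as [p [_ Hp]].
  set (tau := fun W => if excluded_middle_informative (W ⊑ V) then b
                       else if excluded_middle_informative (W ⊥ V) then a else p).
  assert (tb : forall W, W ⊑ V -> tau W = b).
  { intros W HW. unfold tau. now destruct (excluded_middle_informative (W ⊑ V)). }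
  assert (ta : forall W, W ⊥ V -> tau W = a).
  { intros W HW. unfold tau. destruct (excluded_middle_informative (W ⊑ V)) as [C|].
    - now apply orth_not_nest in C.
    - now destruct (excluded_middle_informative (W ⊥ V)). }
  assert (tp : forall W, V ⊏ W \/ V ⋔ W -> tau W = p).
  { intros W HW. unfold tau. destruct (excluded_middle_informative (W ⊑ V)) as [C|].
    - destruct HW as [HW|(_&_&HW)]; [now apply pnest_not_nest in HW|contradiction].
    - destruct (excluded_middle_informative (W ⊥ V)) as [C|]; [|easy]. apply orth_sym in C.
      destruct HW as [[HW _]|(HW&_)]; [now apply orth_not_nest in C|contradiction]. }
  assert (kind : forall W, W ⊑ V \/ W ⊥ V \/ (V ⊏ W \/ V ⋔ W)).
  { intros W. destruct (domain_cases W V) as [C|[C|[C|C]]]; auto. apply trv_sym in C. auto. }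
  (* For [W'] below or orthogonal to [V], [rho W' W] is close to [rho V W], hence to [p]; this
     settles every mixed case of consistency. *)
  assert (near : forall W W', V ⊏ W \/ V ⋔ W -> W' ⊑ V \/ W' ⊥ V -> W' ⊏ W \/ W' ⋔ W ->
    dr W (tau W) W' <= 4 * K).
  { intros W W' HW HW' HWW. rewrite (tp W HW).
    assert (NW : ~ W ⊥ W').
    { intros C. destruct HWW as [[C' _]|(C'&_)].
      - apply orth_sym in C. now apply orth_not_nest in C.
      - now apply C', orth_sym. }
    pose proof (Hp W HW). pose proof (dr_rr W p W' V).
    destruct HW' as [HW'|HW'].
    - pose proof (rho_nest W' V W HW' HW NW). rewrite (rr_sym W V W') in *. lra.
    - pose proof (rho_orth W' V W HW' HWW HW). rewrite (rr_sym W V W') in *. lra. }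
  destruct (realisation tau (a :: b :: p :: nil) (4 * K)) as [x Hx].
  - intros W. simpl. destruct (kind W) as [C|[C|C]];
      [rewrite (tb W C)|rewrite (ta W C)|rewrite (tp W C)]; auto.
  - lra.
  - intros U W HUW.
    assert (Hsame : tau U = tau W -> dr U (tau U) W <= 4 * K \/ dr W (tau W) U <= 4 * K).
    { intros ->. destruct (trv_consistent U W (tau W) HUW); [right|left]; lra. }
    destruct (kind U) as [A|[A|A]]; destruct (kind W) as [B|[B|B]].
    + apply Hsame. now rewrite (tb U A), (tb W B).
    + exfalso. apply (proj1 HUW). apply (orth_nest W U V A), orth_sym, B.
    + right. apply near; tauto.
    + exfalso. apply (proj1 HUW), orth_sym. apply (orth_nest U W V B), orth_sym, A.
    + apply Hsame. now rewrite (ta U A), (ta W B).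
    + right. apply near; tauto.
    + left. apply trv_sym in HUW. apply near; tauto.
    + left. apply trv_sym in HUW. apply near; tauto.
    + apply Hsame. now rewrite (tp U A), (tp W B).
  - intros U W HUW. destruct (kind W) as [B|[B|B]].
    + left. rewrite (tb W B), tb; [easy|]. apply (nest_trans U W V); [apply HUW|exact B].
    + left. rewrite (ta W B), ta; [easy|]. apply (orth_nest V U W); [apply HUW|exact B].
    + destruct (kind U) as [A|[A|A]]; [right; apply near; tauto..|].
      left. now rewrite (tp U A), (tp W B).
  - exists x. unfold mixed_bound. repeat split; intros W HW.
    + specialize (Hx W). rewrite (tb W HW) in Hx. lra.
    + specialize (Hx W). rewrite (ta W HW) in Hx. lra.
    + specialize (Hx W). rewrite (tp W HW) in Hx.
      pose proof (Hp W HW). pose proof (dr_dd W x p V). lra.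
Qed.

Lemma quasiconvex_weaken U (Z : CS H U -> Prop) k k' :
  k <= k' -> quasiconvex (@dC H U) Z k -> quasiconvex (@dC H U) Z k'.
Proof.
  intros Hk Hq g L Hg H0 HL p Hp. destruct (Hq g L Hg H0 HL p Hp) as [q [A B]].
  exists q. split; [exact A|lra].
Qed.

Lemma hqc_quasiconvex (Y : X -> Prop) kappa U : hqc Y kappa ->
  quasiconvex (@dC H U) (projset (@proj H) U Y) (Rabs (kappa 0)).
Proof. intros [Hq _]. apply (quasiconvex_weaken U _ (kappa 0)); [apply Rle_abs|apply Hq]. Qed.

Lemma hqc_near (Y : X -> Prop) kappa x r : hqc Y kappa -> 0 <= r ->
  (forall U, exists y, Y y /\ dd U x y <= r) -> setdist_le (@dX H) (eq x) Y (kappa r).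
Proof.
  intros [_ Hh] Hr Hd. apply Hh; [exact Hr|]. intros U eps He. destruct (Hd U) as [y [Yy Dy]].
  exists (rep U x), (rep U y). split; [apply rep_proj|]. split; [|fold (dd U x y); lra].
  exists y. split; [exact Yy|apply rep_proj].
Qed.

(** * Gates *)

Section Gate.
Variable (Y : X -> Prop) (g : X -> X) (mu k : R).
Hypothesis Hgate : is_gate Y g mu.
Hypothesis Hk : 0 <= k.
Hypothesis Hqc : forall U, quasiconvex (@dC H U) (projset (@proj H) U Y) k.

Lemma projset_rep U y : Y y -> projset (@proj H) U Y (rep U y).
Proof. intros Yy. exists y. split; [exact Yy|apply rep_proj]. Qed.

Lemma gate_mem x : Y (g x). Proof. apply Hgate. Qed.

Lemma gate_closest W x : exists c p, near_closest _ (@dC H W) (projset (@proj H) W Y) p c /\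
  proj H W x p /\ dC H W (rep W (g x)) c <= mu.
Proof.
  destruct Hgate as (_&_&_&Hg). destruct (Hg W x) as [_ Hg2].
  destruct (Hg2 (rep W (g x)) (rep_proj W (g x))) as [c [[Zc [p [Hp Hc]]] Hd]].
  exists c, p. split; [now split|]. split; [exact Hp|]. rewrite dC_sym. exact Hd.
Qed.

(** In [W] the gate is nearly as close to [x] as [y] is; the triangle inequality gives the factor
    [2]. *)
Lemma gate_near W x y : Y y -> dd W (g x) y <= mu + 2 * E + 2 * dd W x y + 1.
Proof.
  intros Yy. destruct (gate_closest W x) as [c [p [[Zc Hc] [Hp Hd]]]].
  pose proof (Hc _ (projset_rep W y Yy)). pose proof (rep_near W x p Hp).
  pose proof (dC_tri W p (rep W x) (rep W y)). rewrite (dC_sym W p (rep W x)) in *.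
  pose proof (dC_tri W (rep W (g x)) c (rep W y)). pose proof (dC_tri W c p (rep W y)).
  rewrite (dC_sym W c p) in *. unfold dd in *. lra.
Qed.

(** Two errors of [gate_near] at points within [K] of their targets, plus the threshold [K] of large
    links. *)
Definition bgi_threshold : R := 2 * (mu + 2 * E + 2 * K + 1) + K.
(** In parentheses: how far apart in [V] the gates of two points near the same relative projection
    can be. *)
Definition bgi_bound : R := K * (2 * mu + 4 * K + 10 * E + 2 * k + 5) + K.

(** Replaces the bounded geodesic image property: partially realise [U] at both points and
    project to [Y] by the gate; the results stay far apart in [U] but are close in [V]. *)
Lemma gated_bounded_geodesic_image U V y y' : U ⊏ V -> Y y -> Y y' ->
  bgi_threshold < dd U y y' -> exists z, Y z /\ dr V z U <= bgi_bound.
Proof.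
  intros HUV Yy Yy' Hd. pose proof K_ge as HK. pose proof E_pos as HE.
  destruct (partial_realisation_single y U) as [q [Q1 Q2]].
  destruct (partial_realisation_single y' U) as [q' [Q1' Q2']].
  specialize (Q2 V (or_introl HUV)). specialize (Q2' V (or_introl HUV)).
  exists (g q). split; [apply gate_mem|].
  assert (Hfar : K < dd U (g q) (g q')).
  { pose proof (gate_near U q y Yy). pose proof (gate_near U q' y' Yy').
    pose proof (dd_tri U y (g q) y'). pose proof (dd_tri U (g q) (g q') y').
    rewrite (dd_sym U y (g q)) in *. unfold bgi_threshold in Hd. lra. }
  assert (Hnear : dd V (g q) (g q') <= 2 * mu + 4 * K + 10 * E + 2 * k + 5).
  { destruct (gate_closest V q) as [c [p [Hc [Hp Dc]]]].
    destruct (gate_closest V q') as [c' [p' [Hc' [Hp' Dc']]]].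
    pose proof (closest_point_coarsely_lipschitz _ _ E (dC_metric V) (dC_geodesic V)
      (dC_hyperbolic V) _ k p p' c c' ltac:(lra) Hk (Hqc V) Hc Hc').
    pose proof (dd_dr V q q' U). pose proof (rep_near V q p Hp). pose proof (rep_near V q' p' Hp').
    pose proof (dC_tri V p (rep V q) p'). pose proof (dC_tri V (rep V q) (rep V q') p').
    rewrite (dC_sym V p (rep V q)) in *.
    pose proof (dC_tri V (rep V (g q)) c (rep V (g q'))).
    pose proof (dC_tri V c c' (rep V (g q'))). rewrite (dC_sym V c' (rep V (g q'))) in *.
    unfold dd in *. lra. }
  pose proof (large_links_near U V (g q) (g q') HUV Hfar). unfold bgi_bound. nra.
Qed.

(** Distance from [a] in [U] forces [x] near [rho U V], and so is some point of [Y], because [Y] is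
    large in [U]. *)
Lemma near_gated_of_nested U V x a R0 y y' : U ⊏ V -> K < dd U x a -> dd V x a <= R0 ->
  Y y -> Y y' -> bgi_threshold < dd U y y' ->
  exists z, Y z /\ dd V x z <= K * R0 + K + bgi_bound.
Proof.
  intros HUV Hxa Ha Yy Yy' Hd.
  destruct (gated_bounded_geodesic_image U V y y' HUV Yy Yy' Hd) as [z [Yz Dz]].
  exists z. split; [exact Yz|].
  pose proof (large_links_near U V x a HUV Hxa). pose proof (dd_dr V x z U).
  pose proof K_ge. nra.
Qed.

(** Turns density of the gate image into closeness to the other set. *)
Lemma gate_near_other_set (B : X -> Prop) W D z w b :
  quasiconvex (@dC H W) (projset (@proj H) W B) k -> 0 <= D ->
  Y z -> B w -> dd W z w <= D -> B b ->
  exists y, B y /\ dd W (g b) y <= mu + 5 * E + 2 * k + D + 2.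
Proof.
  intros QB HD Yz Bw Hzw Bb. pose proof E_pos.
  destruct (gate_closest W b) as [c [p [Hc [Hp Dc]]]].
  destruct (closest_point_near_other_set _ _ E (dC_metric W) (dC_geodesic W) (dC_hyperbolic W)
    (projset (@proj H) W Y) (projset (@proj H) W B) k D (rep W z) (rep W w) p c)
    as [q [[y [By Hq]] Dq]]; trivial; try lra.
  - now apply projset_rep.
  - exists w. split; [exact Bw|apply rep_proj].
  - now exists b.
  - exists y. split; [exact By|]. pose proof (rep_near W y q Hq).
    pose proof (dC_tri W (rep W (g b)) c (rep W y)). pose proof (dC_tri W c q (rep W y)).
    rewrite (dC_sym W q (rep W y)) in *. unfold dd. lra.
Qed.
End Gate.

(** * From a hierarchically quasiconvex union to filled squares *)

Lemma is_gate_weaken (Y : X -> Prop) g mu mu' : mu <= mu' -> is_gate Y g mu -> is_gate Y g mu'.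
Proof.
  intros Hm (A&B&C&D). split; [exact A|]. split; [|split].
  - intros y Yy. specialize (B y Yy). lra.
  - intros x x'. specialize (C x x'). pose proof (metric_pos _ _ dX_metric x x'). nra.
  - intros W x. destruct (D W x) as [D1 D2]. split; intros q Hq;
      [destruct (D1 q Hq) as [p [P1 P2]]|destruct (D2 q Hq) as [p [P1 P2]]];
      exists p; (split; [exact P1|lra]).
Qed.

Lemma not_dense_far W (P Q : X -> Prop) T :
  ~ dense_in (@dC H W) (projset (@proj H) W P) (projset (@proj H) W Q) T ->
  exists q, Q q /\ forall p, P p -> T - E < dd W p q.
Proof.
  intros Hn. apply not_all_ex_not in Hn as [u Hn]. apply imply_to_and in Hn as [[q [Qq Hu]] Hn].
  exists q. split; [exact Qq|]. intros p Pp. apply Rnot_le_lt. intros Hc. apply Hn.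
  exists (rep W p). split; [exists p; split; [exact Pp|apply rep_proj]|].
  pose proof (rep_near W q u Hu). pose proof (dC_tri W (rep W p) (rep W q) u).
  unfold dd in Hc. lra.
Qed.

Lemma fill_of_hqc_union (kappa kappa' : R -> R) (mu : R) : exists T, 0 <= T /\
  forall (A B : X -> Prop) (gA gB : X -> X),
    hqc A kappa -> hqc B kappa -> is_gate A gA mu -> is_gate B gB mu ->
    hqc (setU A B) kappa' -> fill_all_squares A B gA gB T.
Proof.
  pose proof K_ge as HK. pose proof E_pos as HE.
  set (m := Rabs mu). set (k := Rabs (kappa 0)).
  assert (Hm : 0 <= m) by apply Rabs_pos. assert (Hk : 0 <= k) by apply Rabs_pos.
  set (T0 := bgi_threshold m). set (T1 := bgi_bound m k). set (C := mixed_bound).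
  assert (HT0 : 2 * K <= T0) by (unfold T0, bgi_threshold; lra).
  assert (HT1 : 0 <= T1) by (unfold T1, bgi_bound; nra).
  assert (HC : 0 <= C).
  { unfold C, mixed_bound, realisation_bound, rho_bound, bad_bound. nra. }
  (* [R1] bounds the distance in each domain from the mixed point to the union, [R2] then that to
     one point of the union in all domains. *)
  set (R1 := C + T1 + K). set (R2 := K * (Rabs (kappa' R1) + 1) + K).
  assert (HR1 : 0 <= R1) by (unfold R1; lra).
  assert (HR2 : 0 <= R2) by (unfold R2; pose proof (Rabs_pos (kappa' R1)); nra).
  (* [T0 + E] makes [B] large in [V]; the last summand is the bound of [gate_near] at distance
     [C + R2]. *)
  set (T := T0 + E + (m + 2 * E + 2 * (C + R2) + 1)).
  exists T. assert (HT : 0 <= T) by (unfold T; lra). split; [exact HT|].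
  intros A B gA gB HA HB GA GB HAB U V HUV.
  apply (is_gate_weaken _ _ _ m (Rle_abs mu)) in GA, GB.
  apply NNPP. intros Hn. apply not_or_and in Hn as [N1 N2].
  apply not_dense_far in N1 as [a [Aa Fa]]. apply not_dense_far in N2 as [b [Bb Fb]].
  assert (Hb : T0 < dd V (gB a) b).
  { assert (T - E < dd V (gB a) b) by (apply Fb; now exists a). unfold T in *. lra. }
  destruct (mixed_realisation V a b) as [x [X1 [X2 X3]]].
  assert (Hx : setdist_le (@dX H) (eq x) (setU A B) (kappa' R1)).
  { apply hqc_near; trivial. intros W.
    assert (Hrho : V ⊏ W \/ V ⋔ W -> exists y, setU A B y /\ dd W x y <= R1).
    { intros HW.
      (* When [V] and [W] are transverse, [b] and [gB a] are too far apart in [V] to be both near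
         [rho W V], so one of them is near [rho V W]. *)
      assert (Hy : exists y, B y /\ dr W y V <= T1 + K).
      { destruct HW as [HW|HW].
        - destruct (gated_bounded_geodesic_image B gB m k GB Hk
            (fun W => hqc_quasiconvex B kappa W HB) V W (gB a) b HW) as [y [By Dy]]; trivial.
          { now apply (gate_mem B gB m). }
          exists y. split; [exact By|]. fold T1 in Dy. lra.
        - destruct (trv_consistent V W b HW) as [Hb1|Hb1]; [exists b; split; [exact Bb|lra]|].
          destruct (trv_consistent V W (gB a) HW) as [Hb2|Hb2].
          + exists (gB a). split; [now apply (gate_mem B gB m)|lra].
          + exfalso. pose proof (dd_dr V (gB a) b W). lra. }
      destruct Hy as [y [By Dy]]. exists y. split; [now right|].
      pose proof (dd_dr W x y V). specialize (X3 W HW). fold C in X3. unfold R1. lra. }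
    destruct (domain_cases W V) as [D|[D|[D|D]]].
    - exists b. split; [now right|]. specialize (X1 W D). fold C in X1. unfold R1. lra.
    - exists a. split; [now left|]. specialize (X2 W D). fold C in X2. unfold R1. lra.
    - apply Hrho. now left.
    - apply Hrho. right. now apply trv_sym. }
  destruct (Hx 1 Rlt_0_1) as [x' [c [<- [Hc Dc]]]].
  assert (Hxc : forall W, dd W x c <= R2).
  { intros W. pose proof (dd_lipschitz W x c). pose proof (Rle_abs (kappa' R1)). unfold R2. nra. }
  (* If [c] is in [A], it is near [b] in [V], so its gate in [B] is too; symmetrically in [U] for
     [c] in [B]. *)
  destruct Hc as [Ac|Bc].
  - assert (Fc : T - E < dd V (gB c) b) by (apply Fb; now exists c).
    pose proof (gate_near B gB m GB V c b Bb). pose proof (dd_tri V c x b).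
    rewrite (dd_sym V c x) in *. specialize (Hxc V). specialize (X1 V (nest_refl V)). fold C in X1.
    unfold T in Fc. lra.
  - assert (Fc : T - E < dd U (gA c) a) by (apply Fa; now exists c).
    pose proof (gate_near A gA m GA U c a Aa). pose proof (dd_tri U c x a).
    rewrite (dd_sym U c x) in *. specialize (Hxc U). specialize (X2 U HUV). fold C in X2.
    unfold T in Fc. lra.
Qed.

(** * From filled squares to a hierarchically quasiconvex union *)

Lemma setdist_le_weaken (x : X) (P Q : X -> Prop) r r' :
  (forall y, P y -> Q y) -> r <= r' ->
  setdist_le (@dX H) (eq x) P r -> setdist_le (@dX H) (eq x) Q r'.
Proof.
  intros HPQ Hr Hs eps He. destruct (Hs eps He) as [p [q [Hp [Hq Hd]]]].
  exists p, q. split; [exact Hp|]. split; [now apply HPQ|lra].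
Qed.

Lemma dense_near W (P Q : X -> Prop) T q :
  dense_in (@dC H W) (projset (@proj H) W P) (projset (@proj H) W Q) T -> Q q ->
  exists p, P p /\ dd W q p <= T + E.
Proof.
  intros Hd Qq. destruct (Hd (rep W q)) as [u [[p [Pp Hu]] Du]].
  { exists q. split; [exact Qq|apply rep_proj]. }
  exists p. split; [exact Pp|]. pose proof (rep_near W p u Hu).
  pose proof (dC_tri W (rep W q) u (rep W p)).
  rewrite (dC_sym W (rep W q) u), (dC_sym W u (rep W p)) in *. unfold dd. lra.
Qed.

(** All of [A] is far in [U] from [x], hence from [rho V U], so [A] projects to [V] near [rho U V]
    and is bounded there. *)
Lemma transverse_not_far (A : X -> Prop) U V x a z w R0 D M :
  U ⋔ V -> dr U x V <= K -> (forall y, A y -> M < dd U x y) -> 2 * K <= M ->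
  A a -> dd V x a <= R0 -> A z -> dd V z w <= D -> dd V x w <= R0 + 2 * K + D.
Proof.
  intros HUV Hx Hfar HM Aa Ha Az Hzw.
  assert (Hr : forall y, A y -> dr V y U <= K).
  { intros y Ay. destruct (trv_consistent U V y HUV) as [|Hc]; [assumption|exfalso].
    pose proof (Hfar y Ay). pose proof (dd_dr U x y V). lra. }
  pose proof (Hr a Aa). pose proof (Hr z Az). pose proof (dd_dr V a z U).
  pose proof (dd_tri V x a w). pose proof (dd_tri V a z w). lra.
Qed.

Lemma hqc_union_of_fill (kappa : R -> R) (mu D T : R) : exists kappa' : R -> R,
  forall (A B : X -> Prop) (gA gB : X -> X),
    hqc A kappa -> hqc B kappa -> is_gate A gA mu -> is_gate B gB mu ->
    setdist_le (@dX H) A B D -> fill_all_squares A B gA gB T -> hqc (setU A B) kappa'.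
Proof.
  pose proof K_ge as HK. pose proof E_pos as HE.
  set (m := Rabs mu). set (k := Rabs (kappa 0)).
  assert (Hm : 0 <= m) by apply Rabs_pos. assert (Hk : 0 <= k) by apply Rabs_pos.
  set (T0 := bgi_threshold m). set (T1 := bgi_bound m k).
  assert (HT0 : 2 * K <= T0) by (unfold T0, bgi_threshold; lra).
  assert (HT1 : 0 <= T1) by (unfold T1, bgi_bound; nra).
  set (D1 := K * (Rabs D + 1) + K).
  assert (HD1 : 0 <= D1) by (unfold D1; pose proof (Rabs_pos D); nra).
  (* The distance to the other set at which a filled square places a point: density, then
     [gate_near_other_set]. *)
  set (G := Rabs T + E + (m + 5 * E + 2 * k + D1 + 2)).
  assert (HG : 0 <= G) by (unfold G; pose proof (Rabs_pos T); lra).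
  set (R0 := fun r => Rabs r + 2 * E + 1).
  (* The sum of the bounds contradicted in the cases below. *)
  set (M := fun r => R0 r + G + (2 * K + D1) + T0 + (K * R0 r + K + T1)).
  exists (fun r => Rabs (kappa (M r)) + (2 * E + k + D1)).
  intros A B gA gB HA HB GA GB HD HF.
  apply (is_gate_weaken _ _ _ m (Rle_abs mu)) in GA, GB.
  assert (QA := fun W => hqc_quasiconvex A kappa W HA).
  assert (QB := fun W => hqc_quasiconvex B kappa W HB). fold k in QA, QB.
  destruct (HD 1 Rlt_0_1) as [z [w [Az [Bw Hzw]]]].
  assert (Dzw : forall W, dd W z w <= D1).
  { intros W. pose proof (dd_lipschitz W z w). pose proof (Rle_abs D). unfold D1. nra. }
  split.
  - intros U. apply (quasiconvex_weaken U _ (2 * E + k + D1)).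
    { pose proof (Rabs_pos (kappa (M 0))). lra. }
    pose proof (quasiconvex_union _ _ E (dC_metric U) (dC_geodesic U) (dC_hyperbolic U)
      (projset (@proj H) U A) (projset (@proj H) U B) k D1 (rep U z) (rep U w)
      ltac:(lra) Hk HD1 (QA U) (QB U) (projset_rep A U z Az) (projset_rep B U w Bw) (Dzw U)) as Hq.
    assert (Hiff : forall p, projset (@proj H) U (setU A B) p <->
      projset (@proj H) U A p \/ projset (@proj H) U B p).
    { intros p. split.
      - intros [y [[Ay|By] Hp]]; [left|right]; now exists y.
      - intros [[y [Yy Hp]]|[y [Yy Hp]]]; exists y; (split; [|exact Hp]); [now left|now right]. }
    intros g L Hg H0 HL p Hp. apply Hiff in H0, HL.
    destruct (Hq g L Hg H0 HL p Hp) as [q [Zq Dq]]. exists q. split; [now apply Hiff|exact Dq].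
  - intros x r Hr Hx.
    assert (HR0 : 0 <= R0 r) by (unfold R0; pose proof (Rabs_pos r); lra).
    assert (HM : M r = R0 r + G + (2 * K + D1) + T0 + (K * R0 r + K + T1)) by reflexivity.
    assert (HKR : 0 <= K * R0 r) by nra.
    assert (Hnear : forall U, exists y, setU A B y /\ dd U x y <= R0 r).
    { intros U. destruct (Hx U 1 Rlt_0_1) as [p [q [Hp [[y [Yy Hq]] Hd]]]].
      exists y. split; [exact Yy|]. pose proof (rep_near U x p Hp). pose proof (rep_near U y q Hq).
      pose proof (dC_tri U (rep U x) p (rep U y)). pose proof (dC_tri U p q (rep U y)).
      rewrite (dC_sym U q (rep U y)) in *. pose proof (Rle_abs r). unfold dd, R0. lra. }
    destruct (classic (forall U, exists y, A y /\ dd U x y <= M r)) as [NA|FA].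
    { apply (setdist_le_weaken x A _ (kappa (M r))); [now left| |apply hqc_near; trivial; lra].
      pose proof (Rle_abs (kappa (M r))). lra. }
    destruct (classic (forall U, exists y, B y /\ dd U x y <= M r)) as [NB|FB].
    { apply (setdist_le_weaken x B _ (kappa (M r))); [now right| |apply hqc_near; trivial; lra].
      pose proof (Rle_abs (kappa (M r))). lra. }
    exfalso.
    apply not_all_ex_not in FA as [U FA]. apply not_all_ex_not in FB as [V FB].
    assert (FA' : forall y, A y -> M r < dd U x y).
    { intros y Ay. apply Rnot_le_lt. intros Hc. apply FA. now exists y. }
    assert (FB' : forall y, B y -> M r < dd V x y).
    { intros y By. apply Rnot_le_lt. intros Hc. apply FB. now exists y. }
    destruct (Hnear U) as [b [[Ab|Bb] Hb]]; [specialize (FA' b Ab); lra|].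
    destruct (Hnear V) as [a [[Aa|Ba] Ha]]; [|specialize (FB' a Ba); lra].
    pose proof (FA' a Aa) as Fa. pose proof (FB' b Bb) as Fb.
    pose proof (FA' z Az) as Fz. pose proof (FB' w Bw) as Fw.
    assert (Dwz : forall W, dd W w z <= D1) by (intros W; now rewrite dd_sym).
    (* [b] is near [x] and [w] is near [z] in [A], so [B] is large in [U]; likewise [A] in [V]. *)
    assert (Ubw : T0 < dd U b w).
    { pose proof (dd_tri U x b z). pose proof (dd_tri U b w z). specialize (Dwz U). lra. }
    assert (Vaz : T0 < dd V a z).
    { pose proof (dd_tri V x a w). pose proof (dd_tri V a z w). specialize (Dzw V). lra. }
    destruct (classic (U = V)) as [<-|NUV]; [lra|].
    destruct (domain_cases U V) as [HUV|[HUV|[HUV|HUV]]].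
    + destruct (near_gated_of_nested B gB m k GB Hk QB U V x a (R0 r) b w) as [y [By Dy]];
        trivial; try lra; [now split|].
      specialize (FB' y By). fold T1 in Dy. lra.
    + destruct (HF V U (orth_sym U V HUV)) as [Hd|Hd].
      * destruct (dense_near _ _ _ _ a Hd Aa) as [p [[b2 [Bb2 ->]] Dp]].
        destruct (gate_near_other_set A gA m k GA Hk QA B V D1 z w b2 (QB V) HD1 Az Bw (Dzw V) Bb2)
          as [y [By Dy]].
        specialize (FB' y By). pose proof (dd_tri V x a y). pose proof (dd_tri V a (gA b2) y).
        pose proof (Rle_abs T). unfold G in HM. lra.
      * destruct (dense_near _ _ _ _ b Hd Bb) as [p [[a2 [Aa2 ->]] Dp]].
        destruct (gate_near_other_set B gB m k GB Hk QB A U D1 w z a2 (QA U) HD1 Bw Az (Dwz U) Aa2)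
          as [y [Ay Dy]].
        specialize (FA' y Ay). pose proof (dd_tri U x b y). pose proof (dd_tri U b (gB a2) y).
        pose proof (Rle_abs T). unfold G in HM. lra.
    + destruct (near_gated_of_nested A gA m k GA Hk QA V U x b (R0 r) a z) as [y [Ay Dy]];
        trivial; try lra.
      specialize (FA' y Ay). fold T1 in Dy. lra.
    + destruct (trv_consistent U V x HUV) as [Hc|Hc].
      * pose proof (transverse_not_far B V U x b w z (R0 r) D1 (M r) (trv_sym U V HUV) Hc FB'
          ltac:(lra) Bb Hb Bw (Dwz U)). lra.
      * pose proof (transverse_not_far A U V x a z w (R0 r) D1 (M r) HUV Hc FA'
          ltac:(lra) Aa Ha Az (Dzw V)). lra.
Qed.
End HHSGeometry.

(** * The two directions combined *)

Theorem theorem4p10 (H : HHS) (kappa : R -> R) (mu : R) :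
  (* qualitative equivalence *)
  (forall (A B : pt H -> Prop) (gA gB : pt H -> pt H),
     hqc A kappa -> hqc B kappa -> is_gate A gA mu -> is_gate B gB mu ->
     ((exists T, 0 <= T /\ fill_all_squares A B gA gB T) <->
      (exists kappa' : R -> R, hqc (setU A B) kappa'))) /\
  (* T depends only on (X,S), kappa, kappa' (and the gate constant mu) *)
  (forall kappa' : R -> R, exists T, 0 <= T /\
     forall (A B : pt H -> Prop) (gA gB : pt H -> pt H),
       hqc A kappa -> hqc B kappa -> is_gate A gA mu -> is_gate B gB mu ->
       hqc (setU A B) kappa' -> fill_all_squares A B gA gB T) /\
  (* kappa' depends only on (X,S), kappa, d_X(A,B), T (and mu) *)
  (forall D T : R, exists kappa' : R -> R,
     forall (A B : pt H -> Prop) (gA gB : pt H -> pt H),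
       hqc A kappa -> hqc B kappa -> is_gate A gA mu -> is_gate B gB mu ->
       setdist_le (@dX H) A B D -> fill_all_squares A B gA gB T ->
       hqc (setU A B) kappa').
Proof.
  split; [|split].
  - intros A B gA gB HA HB GA GB. split.
    + intros [T [_ HF]]. destruct (pt_inhabited H) as [x].
      (* The gates of any point bound the distance between [A] and [B]. *)
      destruct (hqc_union_of_fill H kappa mu (dX H (gA x) (gB x)) T) as [kappa' Hk].
      exists kappa'. apply (Hk A B gA gB); trivial.
      intros eps He. exists (gA x), (gB x). split; [apply GA|]. split; [apply GB|]. lra.
    + intros [kappa' HU]. destruct (fill_of_hqc_union H kappa kappa' mu) as [T [HT HF]].
      exists T. split; [exact HT|]. now apply HF.
  - intros kappa'. apply fill_of_hqc_union.
  - intros D T. apply hqc_union_of_fill.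
Qed.
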